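(* If $(X,\mathcal D)$ is a model, then the decomposition space $X/\mathcal D$ is naturally a graph, and this graph is a tree.
   Context: A cube is a metric space isometric to $[0,1]^n$; a square complex is a union of cubes of dimension at most 2 glued by isometries of faces. A decomposition of a square $[0,1]^2$ is standard if its elements are the fibers of the projection onto one of its sides; a decomposition of a 1-cube is standard if its elements are points and trivial if its only element is the whole 1-cube. A laminated square complex is a simply connected square complex $X$ with a partition $\mathcal D$ (elements called leaves) such that (M1) the link of every vertex is a simplicial graph with no circuits of length three, and (M2) for each square $C$, the decomposition of $C$ into connected components of intersections with leaves is standard, and for each 1-cube the induced decomposition is standard or trivial. A model is a laminated square complex in which (M3) every leaf is connected. *)

(* Defs.v *)
From HB Require Import structures.
From mathcomp Require Import all_boot all_order all_algebra.
From mathcomp Require Import all_classical all_reals.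
From mathcomp Require Import topology normedtype.
From Stdlib Require Import Relations List.

Set Implicit Arguments.
Unset Strict Implicit.
Unset Printing Implicit Defensive.

Import Order.TTheory GRing.Theory Num.Theory.
Import numFieldNormedType.Exports.
Local Open Scope classical_set_scope.
Local Open Scope ring_scope.

(* Combinatorial data of a complex of cubes of dimension <= 2, glued by     *)
(* isometries of faces.  Every 1-cube e is a copy of [0,1] with endpoint     *)
(* 0 glued to the vertex [csrc e] and endpoint 1 to [ctgt e].  Every square  *)
(* s is a copy of [0,1]^2; its side {x_j = b} (j = false : first coordinate, *)
(* j = true : second coordinate; b = false : value 0, b = true : value 1)    *)
(* is glued isometrically to the 1-cube [cside s j b], with parameter u     *)
(* (the free coordinate) sent to u, or to 1-u when [cflip s j b].           *)
(* A graph is the special case without squares.                            *)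
Record sqcx := SqCx {
  cV : Type; cE : Type; cS : Type;
  csrc : cE -> cV; ctgt : cE -> cV;
  cside : cS -> bool -> bool -> cE;
  cflip : cS -> bool -> bool -> bool }.

Definition endv (K : sqcx) (e : cE K) (i : bool) : cV K :=
  if i then ctgt e else csrc e.

(* Raw points of the disjoint union of the cells (coordinates in R; only
   coordinates in [0,1] are meaningful). *)
Inductive rpt (K : sqcx) (R : Type) : Type :=
| RV : cV K -> rpt K R
| RE : cE K -> R -> rpt K R
| RS : cS K -> R -> R -> rpt K R.
Arguments RV {K R}. Arguments RE {K R}. Arguments RS {K R}.

Section Cells.
Variable R : realType.

Definition in01 (t : R) : Prop := 0 <= t <= 1.
Definition sq01 : set (R * R) := [set q | in01 q.1 /\ in01 q.2].

Definition valid (K : sqcx) (a : rpt K R) : Prop :=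
  match a with
  | RV _ => True
  | RE _ t => in01 t
  | RS _ x y => in01 x /\ in01 y
  end.

Definition b2r (b : bool) : R := if b then 1 else 0.

Definition sqpt (K : sqcx) (s : cS K) (j b : bool) (u : R) : rpt K R :=
  if j then RS s u (b2r b) else RS s (b2r b) u.

Inductive glue (K : sqcx) : rpt K R -> rpt K R -> Prop :=
| glue_src e : glue (RE e 0) (RV (csrc e))
| glue_tgt e : glue (RE e 1) (RV (ctgt e))
| glue_side s j b u : in01 u ->
    glue (sqpt s j b u) (RE (cside s j b) (if cflip s j b then 1 - u else u)).

Definition glued (K : sqcx) : rpt K R -> rpt K R -> Prop :=
  clos_refl_sym_trans _ (@glue K).
End Cells.

(* Coherence of the gluings at the corners: the corner (b0,b1) of a square
   reaches the same vertex through both sides containing it (faces of faces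
   are glued consistently). *)
Definition cornerA (K : sqcx) (s : cS K) (b0 b1 : bool) : cE K * bool :=
  (cside s false b0, xorb b1 (cflip s false b0)).
Definition cornerB (K : sqcx) (s : cS K) (b0 b1 : bool) : cE K * bool :=
  (cside s true b1, xorb b0 (cflip s true b1)).

Definition coherent (K : sqcx) : Prop :=
  forall (s : cS K) (b0 b1 : bool),
    endv (cornerA s b0 b1).1 (cornerA s b0 b1).2 =
    endv (cornerB s b0 b1).1 (cornerB s b0 b1).2.

Definition open_in {T : topologicalType} (A B : set T) : Prop :=
  exists W, open W /\ A `&` B = A `&` W.

(* [p : rpt K R -> X] exhibits the topological space X as the (geometric
   realization of the) complex K: every point comes from a cell, two cell
   points have the same image iff they are identified by the gluings, and X
   carries the weak topology of its cells. *)
Definition realizes (R : realType) (K : sqcx) (X : topologicalType)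
    (p : rpt K R -> X) : Prop :=
  [/\ coherent K,
      (forall x : X, exists a, valid a /\ p a = x),
      (forall a b, valid a -> valid b -> (p a = p b <-> glued a b)) &
      (forall U : set X, open U <->
         ((forall e, open_in (`[0, 1]%classic : set R) [set t | U (p (RE e t))]) /\
          (forall s, open_in (@sq01 R) [set q | U (p (RS s q.1 q.2))])))].

Definition simply_connected (R : realType) (X : topologicalType) : Prop :=
  [/\ (exists x : X, True),
      (forall x y : X, exists g : R -> X,
          {within `[0, 1]%classic, continuous g} /\ g 0 = x /\ g 1 = y) &
      (forall g : R -> X, {within `[0, 1]%classic, continuous g} -> g 0 = g 1 ->
         exists H : R * R -> X, {within @sq01 R, continuous H} /\
           (forall u, in01 u ->
              [/\ H (u, 0) = g u, H (u, 1) = g 0, H (0, u) = g 0 & H (1, u) = g 0]))].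

(* The link of a vertex v: its vertices are the ends (e,i) of 1-cubes with
   endv e i = v, its edges are the corners of squares at v, the corner
   (s,b0,b1) joining cornerA s b0 b1 and cornerB s b0 b1. *)
Definition corner_at (K : sqcx) (v : cV K) (c : cS K * bool * bool) : Prop :=
  endv (cornerA c.1.1 c.1.2 c.2).1 (cornerA c.1.1 c.1.2 c.2).2 = v.

Definition link_adj (K : sqcx) (v : cV K) (a b : cE K * bool) : Prop :=
  exists c, corner_at v c /\
    ((cornerA c.1.1 c.1.2 c.2 = a /\ cornerB c.1.1 c.1.2 c.2 = b) \/
     (cornerA c.1.1 c.1.2 c.2 = b /\ cornerB c.1.1 c.1.2 c.2 = a)).

(* (M1): the link of v is a simplicial graph (no loops, no multiple edges)
   with no circuit of length three. *)
Definition link_condition (K : sqcx) (v : cV K) : Prop :=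
  [/\ (forall c, corner_at v c -> cornerA c.1.1 c.1.2 c.2 <> cornerB c.1.1 c.1.2 c.2),
      (forall c c', corner_at v c -> corner_at v c' ->
         ((cornerA c.1.1 c.1.2 c.2 = cornerA c'.1.1 c'.1.2 c'.2 /\
           cornerB c.1.1 c.1.2 c.2 = cornerB c'.1.1 c'.1.2 c'.2) \/
          (cornerA c.1.1 c.1.2 c.2 = cornerB c'.1.1 c'.1.2 c'.2 /\
           cornerB c.1.1 c.1.2 c.2 = cornerA c'.1.1 c'.1.2 c'.2)) -> c = c') &
      ~ (exists a b d, [/\ a <> b, b <> d & a <> d] /\
           [/\ link_adj v a b, link_adj v b d & link_adj v a d])].

Definition partition_of {X : Type} (D : set (set X)) : Prop :=
  [/\ (forall L, D L -> L !=set0),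
      (forall L L', D L -> D L' -> L `&` L' !=set0 -> L = L') &
      (forall x, exists L, D L /\ L x)].

Section Decomp.
Variables (R : realType) (K : sqcx) (X : topologicalType) (p : rpt K R -> X)
  (D : set (set X)).

Definition sq_decomp (s : cS K) : set (set (R * R)) :=
  [set C | exists L q, [/\ D L,
     [set q' | sq01 q' /\ L (p (RS s q'.1 q'.2))] q &
     C = connected_component [set q' | sq01 q' /\ L (p (RS s q'.1 q'.2))] q]].

Definition edge_decomp (e : cE K) : set (set R) :=
  [set C | exists L t, [/\ D L, [set t' | in01 t' /\ L (p (RE e t'))] t &
     C = connected_component [set t' | in01 t' /\ L (p (RE e t'))] t]].
End Decomp.

Definition std_sq_decomp (R : realType) (C : set (set (R * R))) : Prop :=
  (C = [set F | exists t, in01 t /\ F = [set q | q.1 = t /\ in01 q.2]]) \/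
  (C = [set F | exists t, in01 t /\ F = [set q | in01 q.1 /\ q.2 = t]]).

Definition std_edge_decomp (R : realType) (C : set (set R)) : Prop :=
  C = [set F | exists t, in01 t /\ F = [set t]].

Definition triv_edge_decomp (R : realType) (C : set (set R)) : Prop :=
  C = [set [set t | in01 t]].

Definition laminated (R : realType) (K : sqcx) (X : topologicalType)
    (p : rpt K R -> X) (D : set (set X)) : Prop :=
  [/\ realizes p, simply_connected R X, partition_of D,
      (forall v : cV K, link_condition v) &
      ((forall s, std_sq_decomp (sq_decomp p D s)) /\
       (forall e, std_edge_decomp (edge_decomp p D e) \/
                 triv_edge_decomp (edge_decomp p D e)))].

Definition model (R : realType) (K : sqcx) (X : topologicalType)
    (p : rpt K R -> X) (D : set (set X)) : Prop :=
  laminated p D /\ (forall L, D L -> connected L).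

Record graph := Graph { gV : Type; gE : Type; gsrc : gE -> gV; gtgt : gE -> gV }.

Definition graph_cx (G : graph) : sqcx :=
  @SqCx (gV G) (gE G) Empty_set (@gsrc G) (@gtgt G)
        (fun s _ _ => match s with end) (fun s _ _ => match s with end).

Definition dtail (G : graph) (d : gE G * bool) : gV G :=
  if d.2 then gtgt d.1 else gsrc d.1.
Definition dhead (G : graph) (d : gE G * bool) : gV G :=
  if d.2 then gsrc d.1 else gtgt d.1.

Fixpoint walk (G : graph) (x : gV G) (l : list (gE G * bool)) (y : gV G) : Prop :=
  match l with
  | nil => x = y
  | d :: l' => dtail d = x /\ walk (dhead d) l' y
  end.

(* a tree: nonempty, connected, and without cycles (no closed walk of
   positive length using pairwise distinct edges; this excludes loops and
   multiple edges as well) *)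
Definition is_tree (G : graph) : Prop :=
  [/\ (exists v : gV G, True),
      (forall x y : gV G, exists l, walk x l y) &
      (forall (x : gV G) l, walk x l x -> l <> nil -> ~ NoDup (map fst l))].

(* Main.v *)
Require Import Defs.
From mathcomp Require Import all_boot all_order all_algebra.
From mathcomp Require Import all_classical all_reals.
From mathcomp Require Import topology normedtype generic_quotient.
From mathcomp Require Import ring lra.
From Stdlib Require Import Relation_Operators.
From Stdlib Require List.

Set Implicit Arguments.
Unset Strict Implicit.
Unset Printing Implicit Defensive.

Import Order.TTheory GRing.Theory Num.Theory.
Import numFieldNormedType.Exports.
Local Open Scope classical_set_scope.
Local Open Scope ring_scope.

(* Opposite sides of a square transverse to its fibers are called parallel.  For
   an edge e0 whose decomposition is standard, the indicator c of its parallelism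
   class is a Z/2-valued cellular cocycle, hence (X being simply connected) the
   coboundary of some kappa on the vertices.  This says that the class separates
   X and is coherently oriented, so kappa extends to a continuous
   phi : X -> [0,1] which on every edge parallel to e0 is the oriented coordinate
   and is locally constant off the open strip of the class; each fiber of phi
   over ]0,1[ lies in one leaf.  A leaf L is connected, so phi(L) is an interval;
   if it were nondegenerate, L would contain a segment of e0, which a standard
   decomposition forbids.  So every phi is constant on leaves.  These functions
   show that X/D is the graph whose vertices are the leaves through vertices and
   whose edges are the parallelism classes, and that each of its edges
   separates it. *)

(** * Induction on intervals and elementary continuity *)

(** The supremum of the x with [P l x] is r: a short interval from such an x close to the supremum
    to a point beyond it, or to r, can be appended. *)
Lemma interval_induction (R : realType) (P : R -> R -> Prop) (l r : R) :
  l <= r ->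
  (forall a b c, l <= a -> a <= b -> b <= c -> c <= r -> P a b -> P b c -> P a c) ->
  (forall t, l <= t <= r -> exists2 d, 0 < d & forall a b, l <= a -> a <= t ->
     t <= b -> b <= r -> t - d < a -> b < t + d -> P a b) ->
  P l r.
Proof.
move=> lr Padd Ploc.
pose S := [set x : R | l <= x <= r /\ P l x].
have Sl : S l.
  split; first by lra.
  have [|d d0 H] := Ploc l; first by lra.
  by apply: H; lra.
have Sub : ubound S r by move=> x [/andP[]].
have supS : has_sup S by split; [exists l | exists r].
have mr : sup S <= r by apply: ge_sup => //; exists l.
have lm : l <= sup S by apply: ub_le_sup => //; exists r.
have [|d d0 H] := Ploc (sup S); first by lra.
have [x [xlr Px] mx] := sup_adherent d0 supS.
have xm : x <= sup S by apply: ub_le_sup => //; exists r.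
(* [m'] lies in [S], so it cannot exceed the supremum; since [sup S + d / 2] does, the minimum must
   be [r]. *)
pose m' := Num.min (sup S + d / 2) r.
have Sm' : S m'.
  have m1 : m' <= sup S + d / 2 by rewrite ge_min lexx.
  have m2 : m' <= r by rewrite ge_min lexx orbT.
  have m3 : sup S <= m' by rewrite le_min; apply/andP; split; lra.
  split; first by lra.
  apply: (Padd _ x) => //; try lra.
  by apply: H; lra.
have : m' <= sup S by apply: ub_le_sup => //; exists r.
rewrite ge_min => /orP[|rm]; first by lra.
have -> : r = m'.
  apply/eqP; rewrite eq_le [_ <= r]ge_min lexx orbT andbT.
  by rewrite le_min lexx andbT; lra.
by case: Sm'.
Qed.

Lemma locally_constant_segment (R : realType) (l r : R) (f : R -> bool) :
  l <= r ->
  (forall t, l <= t <= r -> \forall w \near t, l <= w <= r -> f w = f t) ->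
  f l = f r.
Proof.
move=> lr fl.
apply: (@interval_induction R (fun a b => f a = f b)) => //.
  by move=> a b c _ _ _ _ -> ->.
move=> t tlr; have /nbhs_ballP[d /= d0 Hd] := fl t tlr.
exists d => // a b la at_ tb br ad bd.
rewrite (Hd a) ?(Hd b) //; try lra; rewrite /ball /= ltr_norml; lra.
Qed.

Lemma near_continuous (Z Z' : topologicalType) (phi : Z' -> Z) (z : Z') (P : Z -> Prop) :
  continuous phi -> (\forall y \near phi z, P y) -> \forall w \near z, P (phi w).
Proof. by move=> cphi HP; exact: cphi z _ HP. Qed.

Lemma continuous_affine (R : realType) (u v : R) : continuous (fun t : R => u + t * v).
Proof.
move=> t; apply: cvgD; first exact: cvg_cst.
by apply: cvgM; [exact: cvg_id|exact: cvg_cst].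
Qed.

Lemma continuous_pair (Z Z1 Z2 : topologicalType) (f : Z -> Z1) (g : Z -> Z2) :
  continuous f -> continuous g -> continuous (fun z => (f z, g z)).
Proof.
move=> cf cg z.
by apply: (cvg_pair (F := nbhs z) (G := nbhs (f z)) (H := nbhs (g z)));
  [exact: cf|exact: cg].
Qed.

(** * Lifting paths and squares through a locally defined Z/2-bundle *)

Section Lifting.
(* A Z/2-bundle on [X] in charts: [h i] is a local section over [U i], and two
   sections differ by a locally constant function on the overlap of their charts
   ([chart_compat]).  A lift of [F] is a function [k] differing from every
   [h i \o F] by a locally constant function. *)
Variables (X : topologicalType) (I : Type) (U : I -> set X) (h : I -> X -> bool).

Definition cont_on (Z : topologicalType) (A : set Z) (F : Z -> X) :=
  forall z, A z -> forall W, nbhs (F z) W -> \forall w \near z, A w -> W (F w).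

Lemma within_continuousP (Z : topologicalType) (A : set Z) (F : Z -> X) :
  {within A, continuous F} <-> cont_on A F.
Proof.
rewrite subspace_continuousP; split=> H z Az W /=.
  by move=> /(H z Az).
by move=> WF; have := H z Az W WF.
Qed.

Definition lift_on (Z : topologicalType) (A : set Z) (F : Z -> X) (k : Z -> bool) :=
  forall i z, A z -> U i (F z) ->
    \forall w \near z, A w -> U i (F w) ->
      k w (+) h i (F w) = k z (+) h i (F z).

Section OneSpace.
Variable (Z : topologicalType).
Implicit Types (A B : set Z) (F : Z -> X) (k : Z -> bool).

(** Near a point outside a closed set the condition on that set is vacuous, so both conditions hold
    near every point of the union. The same argument gives [lift_on_paste]. *)
Lemma cont_on_paste A B F : closed A -> closed B -> cont_on A F -> cont_on B F ->
  cont_on (A `|` B) F.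
Proof.
move=> cA cB FA FB z ABz W WF.
have side C : closed C -> cont_on C F -> \forall w \near z, C w -> W (F w).
  move=> cC FC; case: (pselect (C z)) => [Cz|nCz]; first exact: FC.
  have : nbhs z (~` C) by apply: open_nbhs_nbhs; split => //; exact: closed_openC.
  by apply: filterS => w nCw /nCw.
by apply: filterS2 (side A cA FA) (side B cB FB) => w HA HB [/HA|/HB].
Qed.

Lemma lift_on_paste A B F k : closed A -> closed B -> lift_on A F k ->
  lift_on B F k -> lift_on (A `|` B) F k.
Proof.
move=> cA cB FA FB i z ABz Uz.
have side C : closed C -> lift_on C F k -> \forall w \near z, C w -> U i (F w) ->
   k w (+) h i (F w) = k z (+) h i (F z).
  move=> cC FC; case: (pselect (C z)) => [Cz|nCz]; first exact: FC.
  have : nbhs z (~` C) by apply: open_nbhs_nbhs; split => //; exact: closed_openC.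
  by apply: filterS => w nCw /nCw.
by apply: filterS2 (side A cA FA) (side B cB FB) => w HA HB [/HA|/HB].
Qed.

Lemma lift_on_eq A F k k' : (forall z, A z -> k z = k' z) ->
  lift_on A F k -> lift_on A F k'.
Proof.
move=> kk H i z Az Uz; have := H i z Az Uz.
by apply: filterS => w Hw Aw Uw; rewrite -!kk // Hw.
Qed.

Lemma lift_on_sub A B F k : B `<=` A -> lift_on A F k -> lift_on B F k.
Proof.
move=> BA H i z Bz Uz; have := H i z (BA _ Bz) Uz.
by apply: filterS => w Hw Bw; apply: Hw; exact: BA.
Qed.

Lemma lift_on_shift A F k b : lift_on A F k -> lift_on A F (fun z => k z (+) b).
Proof.
move=> H i z Az Uz; have := H i z Az Uz.
by apply: filterS => w Hw Aw Uw; rewrite -!(addbAC _ (h _ _)) Hw.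
Qed.
End OneSpace.

Lemma lift_on_comp (Z Z' : topologicalType) (A : set Z) (A' : set Z')
    (phi : Z' -> Z) F k : continuous phi -> (forall z, A' z -> A (phi z)) ->
  lift_on A F k -> lift_on A' (F \o phi) (k \o phi).
Proof.
move=> cphi sub H i z A'z Uz; have := near_continuous cphi (H i (phi z) (sub _ A'z) Uz).
by apply: filterS => w Hw A'w Uw; apply: Hw => //; exact: sub.
Qed.

Lemma cont_on_comp (Z Z' : topologicalType) (A : set Z) (A' : set Z')
    (phi : Z' -> Z) F : continuous phi -> (forall z, A' z -> A (phi z)) ->
  cont_on A F -> cont_on A' (F \o phi).
Proof.
move=> cphi sub H z A'z W WF; have := near_continuous cphi (H (phi z) (sub _ A'z) W WF).
by apply: filterS => w Hw A'w; apply: Hw => //; exact: sub.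
Qed.

Lemma cont_on_sub (Z : topologicalType) (A B : set Z) F :
  B `<=` A -> cont_on A F -> cont_on B F.
Proof.
move=> BA FA; apply: (@cont_on_comp _ _ A _ id) => // z; exact: cvg_id.
Qed.

Hypothesis chart_cover : forall x, exists i, U i x.
Hypothesis chart_compat : forall i j x, U i x -> U j x ->
  \forall y \near x,
    [/\ U i y, U j y & h i y (+) h j y = h i x (+) h j x].

(** In a chart around [F z] both lifts differ from [h i \o F] by local constants, and [h i \o F]
    cancels in the sum. With equal indices, [chart_compat] says that the chart is a neighbourhood of
    [F z]. *)
Lemma lift_on_diff (Z : topologicalType) (A : set Z) F k k' :
  cont_on A F -> lift_on A F k -> lift_on A F k' ->
  forall z, A z -> \forall w \near z, A w -> k w (+) k' w = k z (+) k' z.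
Proof.
move=> cF kl kl' z Az; have [i Ui] := chart_cover (F z).
apply: filterS3 (cF z Az _ (chart_compat Ui Ui)) (kl i z Az Ui) (kl' i z Az Ui)
  => w H1 H2 H3 Aw; have [Uw _ _] := H1 Aw.
move: (H2 Aw Uw) (H3 Aw Uw).
by move: (k w) (k' w) (h i (F w)) (k z) (k' z) (h i (F z)) => [] [] [] [] [] [].
Qed.

(** * Lifting maps on rectangles *)

Section Plane.
Variable R : realType.

Definition rect (a b c d : R) : set (R * R) :=
  [set z | a <= z.1 <= b /\ c <= z.2 <= d].

Lemma closed_rect a b c d : closed (rect a b c d).
Proof.
have -> : rect a b c d =
    (fst @^-1` `[a, b]%classic) `&` (snd @^-1` `[c, d]%classic).
  by apply/seteqP; split => z; rewrite /rect /= !in_itv.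
apply: closedI; apply: closed_comp => //; try by move=> z _; exact: cvg_fst.
- exact: interval_closed.
- by move=> z _; exact: cvg_snd.
- exact: interval_closed.
Qed.

Lemma rect_cupl a b e c d : a <= b -> b <= e ->
  rect a b c d `|` rect b e c d = rect a e c d.
Proof.
move=> ab be; apply/seteqP; split => z; rewrite /rect /=.
  by move=> [[]|[]] z1 z2; split; lra.
by move=> [z1 z2]; case: (leP z.1 b) => zb; [left|right]; split; lra.
Qed.

Lemma rect_capl a b e c d : a <= b -> b <= e ->
  rect a b c d `&` rect b e c d = rect b b c d.
Proof.
move=> ab be; apply/seteqP; split => z; rewrite /rect /=.
  by move=> [[? ?] [? ?]]; split; lra.
by move=> [? ?]; split; split; lra.
Qed.

Lemma rect_cupr a b c d e : c <= d -> d <= e ->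
  rect a b c d `|` rect a b d e = rect a b c e.
Proof.
move=> cd de; apply/seteqP; split => z; rewrite /rect /=.
  by move=> [[]|[]] z1 z2; split; lra.
by move=> [z1 z2]; case: (leP z.2 d) => zb; [left|right]; split; lra.
Qed.

Lemma rect_capr a b c d e : c <= d -> d <= e ->
  rect a b c d `&` rect a b d e = rect a b d d.
Proof.
move=> cd de; apply/seteqP; split => z; rewrite /rect /=.
  by move=> [[? ?] [? ?]]; split; lra.
by move=> [? ?]; split; split; lra.
Qed.

Lemma locally_constant_rect (a b c d : R) (f : R * R -> bool) :
  (forall z, rect a b c d z ->
     \forall w \near z, rect a b c d w -> f w = f z) ->
  forall z z', rect a b c d z -> rect a b c d z' -> f z = f z'.
Proof.
move=> fl z z' Az Az'.
pose g (t : R) := (z.1 + t * (z'.1 - z.1), z.2 + t * (z'.2 - z.2)) : R * R.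
have gc : continuous g.
  by apply: continuous_pair; exact: continuous_affine.
have gr t : 0 <= t <= 1 -> rect a b c d (g t).
  by move: Az Az' => [] /= ? ? [] /= ? ? ?; split => /=; nra.
have g0 : g 0 = z by rewrite /g !mul0r !addr0 -surjective_pairing.
have g1 : g 1 = z' by rewrite /g !mul1r !subrKC -surjective_pairing.
have := @locally_constant_segment R 0 1 (f \o g) ler01.
rewrite /= g0 g1; apply.
move=> t t01; have := near_continuous gc (fl _ (gr t t01)).
by apply: filterS => w H w01; apply: H; exact: gr.
Qed.

Definition liftable (F : R * R -> X) (A : set (R * R)) := exists k, lift_on A F k.

(** Two lifts differ by a constant on the overlap, which is a rectangle; shifting one of them by
    this constant lets them glue. *)
Lemma liftable_union F (A B : set (R * R)) a b c d : closed A -> closed B ->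
  A `&` B = rect a b c d -> cont_on A F -> cont_on B F ->
  liftable F A -> liftable F B -> liftable F (A `|` B).
Proof.
move=> cA cB AB FA FB [k kA] [k' kB].
have subA : rect a b c d `<=` A by rewrite -AB => z [].
have subB : rect a b c d `<=` B by rewrite -AB => z [].
have FAB : cont_on (rect a b c d) F by exact: cont_on_sub FA.
have const := locally_constant_rect
  (lift_on_diff FAB (lift_on_sub subA kA) (lift_on_sub subB kB)).
have [b0 Hb0] : exists b0, forall z, rect a b c d z -> k z = k' z (+) b0.
  case: (pselect (rect a b c d !=set0)) => [[z0 Rz0]|n0].
    exists (k z0 (+) k' z0) => z Rz; have := const z0 z Rz0 Rz.
    by move: (k z0) (k' z0) (k z) (k' z) => [] [] [] [].
  by exists false => z Rz; exfalso; apply: n0; exists z.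
exists (fun z => if `[< A z >] then k z else k' z (+) b0).
apply: lift_on_paste => //.
  by apply: lift_on_eq kA => z Az; rewrite asboolT.
apply: lift_on_eq (lift_on_shift b0 kB) => z Bz.
by case: asboolP => // Az; rewrite Hb0 // -AB.
Qed.

(** Two nested inductions on intervals: a small rectangle around each point maps into one chart [i],
    where [h i \o F] is a lift; such rectangles are stacked to a thin strip, and the strips are
    joined. *)
Lemma liftable_square (F : R * R -> X) :
  cont_on (rect 0 1 0 1) F -> liftable F (rect 0 1 0 1).
Proof.
move=> cF.
have cFs a b c d : 0 <= a -> b <= 1 -> 0 <= c -> d <= 1 -> cont_on (rect a b c d) F.
  by move=> *; apply: cont_on_sub cF => z [] /= ? ?; split; lra.
apply: (@interval_induction R (fun a b => liftable F (rect a b 0 1)) 0 1) => //.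
  move=> a b c a0 ab bc c1 H1 H2.
  rewrite -(rect_cupl _ _ ab bc).
  apply: liftable_union (rect_capl _ _ ab bc) _ _ H1 H2; try exact: closed_rect.
  - by apply: cFs; lra.
  - by apply: cFs; lra.
move=> t t01.
(* The width [e] may depend on the height interval, so that stacking two strips can take the smaller
   width. *)
pose strip c d := exists2 e, 0 < e & forall a b,
  0 <= a -> a <= t -> t <= b -> b <= 1 -> t - e < a -> b < t + e ->
  liftable F (rect a b c d).
suff : strip 0 1 by [].
apply: interval_induction => //.
  move=> c d f c0 cd df f1 [e1 e10 H1] [e2 e20 H2].
  exists (Num.min e1 e2); first by rewrite lt_min e10.
  move=> a b a0 at_ tb b1 ae be.
  have m1 : Num.min e1 e2 <= e1 by rewrite ge_min lexx.
  have m2 : Num.min e1 e2 <= e2 by rewrite ge_min lexx orbT.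
  rewrite -(rect_cupr _ _ cd df).
  apply: liftable_union (rect_capr _ _ cd df) _ _ _ _; try exact: closed_rect.
  - by apply: cFs; lra.
  - by apply: cFs; lra.
  - by apply: H1; lra.
  - by apply: H2; lra.
move=> u u01; have Rtu : rect 0 1 0 1 (t, u) by split.
have [i Ui] := chart_cover (F (t, u)).
have /nbhs_ballP[e /= e0 He] := cF _ Rtu _ (chart_compat Ui Ui).
exists e => // c d c0 cu ud d1 ce de; exists e => // a b a0 at_ tb b1 ae be.
have inU z : rect a b c d z -> U i (F z).
  case: z => z1 z2 [/= ? ?]; case: (He (z1, z2)) => //.
    by split; rewrite /ball /= ltr_norml; lra.
  by split => /=; lra.
exists (fun z => h i (F z)) => j z Az Uj.
have := cFs a b c d a0 b1 c0 d1 z Az _ (chart_compat (inU z Az) Uj).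
by apply: filterS => w H Aw _; have [] := H Aw.
Qed.
End Plane.

(** * Monodromy along paths and its potential *)

Section Monodromy.
Variable R : realType.
Hypothesis Xsc : simply_connected R X.

Definition seg01 : set R := [set t | 0 <= t <= 1].

Lemma seg01E : seg01 = `[0, 1]%classic.
Proof. by apply/seteqP; split => t; rewrite /seg01 /= in_itv. Qed.

(** A relation, because independence of [b] from the path is the consequence of simple connectedness
    still to be proved. *)
Definition transport (x y : X) (b : bool) := exists g k,
  [/\ cont_on seg01 g, g 0 = x, g 1 = y, lift_on seg01 g k & k 0 (+) k 1 = b].

Lemma path_liftable (g : R -> X) : cont_on seg01 g -> exists k, lift_on seg01 g k.
Proof.
move=> cg.
(* The path becomes a map on the square, constant in the second coordinate; its lift is restricted
   to the bottom side. *)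
have [|k Hk] := @liftable_square R (g \o fst).
  by apply: cont_on_comp cg => [z|z [] //]; exact: cvg_fst.
exists (k \o (fun u => (u, 0))).
have -> : g = (g \o fst) \o (fun u : R => (u, 0 : R)) by [].
apply: lift_on_comp Hk => [|u u01].
  by apply: continuous_pair => u; [exact: cvg_id|exact: cvg_cst].
by split => //=; rewrite lexx ler01.
Qed.

Lemma lift_end_unique (g : R -> X) k k' : cont_on seg01 g ->
  lift_on seg01 g k -> lift_on seg01 g k' -> k 0 (+) k 1 = k' 0 (+) k' 1.
Proof.
move=> cg lk lk'.
have := @locally_constant_segment R 0 1 (fun t => k t (+) k' t) ler01
  (lift_on_diff cg lk lk').
by move: (k 0) (k 1) (k' 0) (k' 1) => [] [] [] [].
Qed.

Lemma lift_cst x : lift_on seg01 (fun _ : R => x) (fun _ => false).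
Proof. by move=> i z _ _; apply: (@filterE _ (nbhs z)) => w. Qed.

Lemma cont_cst x : cont_on seg01 (fun _ : R => x).
Proof. by move=> z _ W /nbhs_singleton Wx; apply: (@filterE _ (nbhs z)) => w. Qed.

Lemma transport_ex x y : exists b, transport x y b.
Proof.
case: Xsc => _ /(_ x y)[g [gc [g0 g1]]] _.
have cg : cont_on seg01 g by rewrite seg01E; exact/within_continuousP.
by have [k Hk] := path_liftable cg; exists (k 0 (+) k 1), g, k.
Qed.

(** A null homotopy lifts to a function [K] on the square. On each of the three sides where the
    homotopy is constant, [K] agrees at the two ends, hence also on the fourth side, where it lifts
    [g]. *)
Lemma transport_loop x b : transport x x b -> b = false.
Proof.
case=> g [k [cg g0 g1 lk <-]].
case: Xsc => _ _ /(_ g); case.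
- by apply/within_continuousP; rewrite -seg01E.
- by rewrite g0 g1.
move=> H [/within_continuousP cH Hb].
have sqE : @sq01 R = rect 0 1 0 1 :> set (R * R) by [].
have cHr : cont_on (rect 0 1 0 1) H by rewrite -sqE.
have [K lK] := liftable_square cHr.
have i0 : in01 (0 : R) by rewrite /in01 lexx ler01.
have i1 : in01 (1 : R) by rewrite /in01 lexx ler01.
(* Along a side, [K] has the same total change as any given lift [m] of the boundary path. *)
have side (phi : R -> R * R) G m : continuous phi ->
    (forall u, in01 u -> rect 0 1 0 1 (phi u)) ->
    (forall u, in01 u -> H (phi u) = G u) -> cont_on seg01 G -> lift_on seg01 G m ->
    K (phi 0) (+) K (phi 1) = m 0 (+) m 1.
  move=> cphi sphi HG cG lm; apply: (@lift_end_unique G (K \o phi) m) => // i z Az Uz.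
  have := @lift_on_comp _ _ _ seg01 phi _ _ cphi sphi lK i z Az.
  rewrite /= HG // => /(_ Uz); apply: filterS => w H1 Aw Uw.
  by move: (H1 Aw); rewrite HG //; apply.
have cid : continuous (@id R) by move=> u; exact: cvg_id.
have cc (x0 : R) : continuous (fun _ : R => x0) by move=> u; exact: cvg_cst.
have e1 := side (fun u => (u, 0)) g k (continuous_pair cid (cc _)) (fun u iu => conj iu i0)
  (fun u iu => let: And4 e _ _ _ := Hb u iu in e) cg lk.
have e2 := side (fun u => (u, 1)) _ _ (continuous_pair cid (cc _)) (fun u iu => conj iu i1)
  (fun u iu => let: And4 _ e _ _ := Hb u iu in e) (@cont_cst _) (@lift_cst _).
have e3 := side (fun u => (0, u)) _ _ (continuous_pair (cc _) cid) (fun u iu => conj i0 iu)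
  (fun u iu => let: And4 _ _ e _ := Hb u iu in e) (@cont_cst _) (@lift_cst _).
have e4 := side (fun u => (1, u)) _ _ (continuous_pair (cc _) cid) (fun u iu => conj i1 iu)
  (fun u iu => let: And4 _ _ _ e := Hb u iu in e) (@cont_cst _) (@lift_cst _).
move: e1 e2 e3 e4; move: (k 0 (+) k 1) (K (0, 0)) (K (0, 1)) (K (1, 0)) (K (1, 1)).
by move=> [] [] [] [] [].
Qed.

Lemma transport_trans x y z b b' :
  transport x y b -> transport y z b' -> transport x z (b (+) b').
Proof.
case=> g [k [cg g0 g1 lk <-]] [g' [k' [cg' g0' g1' lk' <-]]].
pose A := [set t : R | 0 <= t <= 2^-1]; pose B := [set t : R | 2^-1 <= t <= 1].
have cA : closed A.
  rewrite (_ : A = `[0, 2^-1]%classic); first exact: interval_closed.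
  by apply/seteqP; split => t; rewrite /A /= in_itv.
have cB : closed B.
  rewrite (_ : B = `[2^-1, 1]%classic); first exact: interval_closed.
  by apply/seteqP; split => t; rewrite /B /= in_itv.
have AB : seg01 = A `|` B.
  apply/seteqP; split => t; rewrite /A /B /seg01 /=; last by case; lra.
  by case: (leP t 2^-1) => *; [left|right]; lra.
have c1 : continuous (fun t : R => 2 * t).
  by move=> t; apply: cvgM; [exact: cvg_cst|exact: cvg_id].
have c2 : continuous (fun t : R => 2 * t - 1).
  by move=> t; apply: cvgB; [exact: c1|exact: cvg_cst].
have s1 t : A t -> seg01 (2 * t) by rewrite /A /seg01 /=; lra.
have s2 t : B t -> seg01 (2 * t - 1) by rewrite /B /seg01 /=; lra.
pose G t := if t <= 2^-1 then g (2 * t) else g' (2 * t - 1).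
(* The shift by [k 1 (+) k' 0] makes the two lifts agree at the junction. *)
pose m t := if t <= 2^-1 then k (2 * t) else k' (2 * t - 1) (+) (k 1 (+) k' 0).
have GA t : A t -> G t = g (2 * t) by rewrite /A /G /= => /andP[_ ->].
have mA t : A t -> m t = k (2 * t) by rewrite /A /m /= => /andP[_ ->].
have half : 2 * 2^-1 = 1 :> R by lra.
have GB t : B t -> G t = g' (2 * t - 1).
  rewrite /B /G /= => tB; case: ifP => // th.
  have -> : t = 2^-1 by lra.
  by rewrite half subrr g1 g0'.
have mB t : B t -> m t = k' (2 * t - 1) (+) (k 1 (+) k' 0).
  rewrite /B /m /= => tB; case: ifP => // th.
  have -> : t = 2^-1 by lra.
  by rewrite half subrr; move: (k 1) (k' 0) => [] [].
have ext (C : set R) G1 G2 : (forall t, C t -> G1 t = G2 t) -> cont_on C G2 -> cont_on C G1.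
  move=> E c t Ct W; rewrite E // => /(c t Ct); apply: filterS => w H Cw.
  by rewrite E //; exact: H.
have extl (C : set R) G1 G2 n1 n2 : (forall t, C t -> G1 t = G2 t) ->
    (forall t, C t -> n1 t = n2 t) -> lift_on C G2 n2 -> lift_on C G1 n1.
  move=> E E' c i t Ct; rewrite E // E' // => /(c i t Ct); apply: filterS => w H Cw.
  by rewrite E // E' //; exact: H.
have cG : cont_on seg01 G.
  rewrite AB; apply: cont_on_paste => //.
    by apply: ext GA _; exact: cont_on_comp c1 s1 cg.
  by apply: ext GB _; exact: cont_on_comp c2 s2 cg'.
have lG : lift_on seg01 G m.
  rewrite AB; apply: lift_on_paste => //.
    by apply: (extl _ _ _ _ _ GA mA); exact: lift_on_comp c1 s1 lk.
  apply: (extl _ _ _ _ _ GB mB); exact: lift_on_shift (lift_on_comp c2 s2 lk').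
have A0 : A 0 by rewrite /A /=; lra.
have B1 : B 1 by rewrite /B /=; lra.
have one : 2 * 1 - 1 = 1 :> R by ring.
exists G, m; split => //; first by rewrite GA // mulr0.
  by rewrite GB // one.
rewrite mA // mB // mulr0 one.
by move: (k 0) (k 1) (k' 0) (k' 1) => [] [] [] [].
Qed.

Lemma monodromy_potential : exists kappa : X -> bool, forall g k,
  cont_on seg01 g -> lift_on seg01 g k -> kappa (g 0) (+) kappa (g 1) = k 0 (+) k 1.
Proof.
(* Both paths are closed up by a common return path, and [transport_loop] applies to each loop. *)
have uniq x y b b' : transport x y b -> transport x y b' -> b = b'.
  move=> H H'; have [c Hc] := transport_ex y x.
  move: (transport_loop (transport_trans H Hc)) (transport_loop (transport_trans H' Hc)).
  by move: b b' c {H H' Hc} => [] [] [].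
case: Xsc => [[x0 _] _ _].
(* [kappa x] is the transport from the base point [x0] to [x]. *)
have [kappa Hk] := choice (transport_ex x0).
exists kappa => g k cg lk.
have H : transport (g 0) (g 1) (k 0 (+) k 1) by exists g, k.
rewrite (uniq _ _ _ _ (Hk (g 1)) (transport_trans (Hk (g 0)) H)).
by rewrite addbA addbb.
Qed.
End Monodromy.
End Lifting.

Lemma open_inP (T : topologicalType) (A B : set T) :
  open_in A B <-> forall z, A z -> B z -> \forall w \near z, A w -> B w.
Proof.
split=> [[W [oW AB]] z Az Bz|H].
  have : nbhs z W.
    by apply: open_nbhs_nbhs; split => //; have : (A `&` B) z by []; rewrite AB => -[].
  apply: filterS => w Ww Aw; have : (A `&` W) w by [].
  by rewrite -AB => -[].
exists (interior [set w | A w -> B w]); split; first exact: open_interior.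
apply/seteqP; split => z [Az Hz]; split => //; first exact: H.
by have := nbhs_singleton Hz; apply.
Qed.

(** * The cocycle of a parallelism class is a coboundary *)

Section Complex.
Variables (R : realType) (K : sqcx) (X : topologicalType) (p : rpt K R -> X).
Hypothesis p_real : realizes p.

Definition flipc (f : bool) (u : R) : R := if f then 1 - u else u.

Lemma flipc_in01 f u : in01 u -> in01 (flipc f u).
Proof. by rewrite /in01 /flipc; case: f => //; lra. Qed.

Lemma b2r_in01 b : in01 (b2r R b).
Proof. by rewrite /in01 /b2r; case: b; rewrite lexx ler01. Qed.

Lemma glue_valid (a b : rpt K R) : Defs.glue a b -> valid a /\ valid b.
Proof.
case=> [e|e|s j b' u u01]; split => //=; try exact: (b2r_in01 false);
  try exact: (b2r_in01 true); last exact: flipc_in01.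
by rewrite /sqpt; case: j; split => //; exact: b2r_in01.
Qed.

Lemma descend (T : Type) (f : rpt K R -> T) :
  (forall a b, Defs.glue a b -> f a = f b) ->
  exists F : X -> T, forall a, valid a -> F (p a) = f a.
Proof.
case: p_real => _ psurj pinj _ fglue.
have fglued a b : glued a b -> f a = f b.
  by elim=> [x y /fglue|x|x y _ ->|x y z _ -> _ ->].
have [r Hr] := choice psurj.
exists (f \o r) => a va /=; have [vr pr] := Hr (p a).
by apply: fglued; apply/pinj.
Qed.

Lemma weak_open (P : set X) :
  (forall e t, in01 t -> P (p (RE e t)) ->
     \forall w \near t, in01 w -> P (p (RE e w))) ->
  (forall s x y, in01 x -> in01 y -> P (p (RS s x y)) ->
     \forall w \near (x, y), sq01 w -> P (p (RS s w.1 w.2))) ->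
  open P.
Proof.
case: p_real => _ _ _ popen HE HS; apply/popen; split=> [e|s]; apply/open_inP.
  move=> t /=; rewrite in_itv /= => t01 Pt; have := HE e t t01 Pt.
  by apply: filterS => w H; rewrite in_itv.
by move=> [x y] [/= x01 y01] /= Pxy; exact: HS.
Qed.

Lemma edge_path_continuous e : cont_on (@seg01 R) (fun t => p (RE e t)).
Proof.
move=> t t01 W; rewrite nbhsE => -[W' [oW' W't] W'W].
case: p_real => _ _ _ popen; have [/(_ e) + _] := (popen W').1 oW'.
rewrite -seg01E => /open_inP /(_ t t01 W't); apply: filterS => w H w01.
by apply: W'W; exact: H.
Qed.

(** One-way on purpose: [x'] keeps the strict inequalities that [x] satisfies. These are open
    conditions, so a set stable under the relation in every cell is open. *)
Definition same_zone (x x' : R) : Prop :=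
  [/\ 0 < x -> 0 < x', x < 1 -> x' < 1, x < 2^-1 -> x' < 2^-1 & 2^-1 < x -> 2^-1 < x'].

Lemma near_same_zone x : \forall x' \near x, same_zone x x'.
Proof.
have up (c : R) : \forall x' \near x, c < x -> c < x'.
  case: (ltP c x) => [cx|_]; last by apply: (@filterE _ (nbhs x)) => w.
  by have := lt_nbhsr cx; apply: filterS.
have down (c : R) : \forall x' \near x, x < c -> x' < c.
  case: (ltP x c) => [cx|_]; last by apply: (@filterE _ (nbhs x)) => w.
  by have := lt_nbhsl cx; apply: filterS.
apply: filterS2 (filterI (up 0) (up 2^-1)) (filterI (down 1) (down 2^-1)).
by move=> w [? ?] [? ?].
Qed.

Lemma zone_open (P : set X) :
  (forall e t t', in01 t -> in01 t' -> same_zone t t' ->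
     P (p (RE e t)) -> P (p (RE e t'))) ->
  (forall s x y x' y', in01 x -> in01 y -> in01 x' -> in01 y' ->
     same_zone x x' -> same_zone y y' ->
     P (p (RS s x y)) -> P (p (RS s x' y'))) ->
  open P.
Proof.
move=> HE HS; apply: weak_open => [e t t01 Pt|s x y x01 y01 Pxy].
  by have := near_same_zone t; apply: filterS => w zw w01; exact: HE zw Pt.
exists (same_zone x, same_zone y); first by split; exact: near_same_zone.
by move=> [w1 w2] [/= z1 z2] [/= w101 w201]; exact: HS Pxy.
Qed.

Section Direction.
(* [d s] is the [j] such that the sides [cside s j b] are transverse to the
   fibers of [s]; [sqp s a b] has transverse coordinate [a]. *)
Variable d : cS K -> bool.

Definition sqp (s : cS K) (a b : R) : rpt K R := if d s then RS s a b else RS s b a.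

Lemma cell_fun (T : Type) (fV : cV K -> T) (fE : cE K -> R -> T)
    (fS : cS K -> R -> R -> T) :
  (forall e, fE e 0 = fV (csrc e)) -> (forall e, fE e 1 = fV (ctgt e)) ->
  (forall s b u, in01 u ->
     fS s u (b2r R b) = fE (cside s (d s) b) (flipc (cflip s (d s) b) u)) ->
  (forall s b u, in01 u ->
     fS s (b2r R b) u = fE (cside s (~~ d s) b) (flipc (cflip s (~~ d s) b) u)) ->
  exists F : X -> T, [/\ forall v, F (p (RV v)) = fV v,
    forall e t, in01 t -> F (p (RE e t)) = fE e t &
    forall s a b, in01 a -> in01 b -> F (p (sqp s a b)) = fS s a b].
Proof.
move=> H0 H1 Hd Hn.
pose f (a : rpt K R) : T := match a with RV v => fV v | RE e t => fE e t
  | RS s x y => if d s then fS s x y else fS s y x end.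
have [|F HF] := @descend T f.
  move=> _ _ [e|e|s j b u u01] //=.
  have := Hd s b u u01; have := Hn s b u u01.
  by rewrite /sqpt /f /flipc; case: j => /=; case: (d s).
exists F; split=> [v|e t t01|s a b a01 b01]; try by rewrite HF.
by rewrite /sqp; case ds : (d s); rewrite HF //= ds.
Qed.

Lemma zone_open_sqp (P : set X) :
  (forall e t t', in01 t -> in01 t' -> same_zone t t' ->
     P (p (RE e t)) -> P (p (RE e t'))) ->
  (forall s x y x' y', in01 x -> in01 y -> in01 x' -> in01 y' ->
     same_zone x x' -> same_zone y y' ->
     P (p (sqp s x y)) -> P (p (sqp s x' y'))) ->
  open P.
Proof.
move=> HE HS; apply: zone_open => // s x y x' y' x01 y01 x01' y01' zx zy.
have := HS s x y x' y' x01 y01 x01' y01' zx zy.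
have := HS s y x y' x' y01 x01 y01' x01' zy zx.
by rewrite /sqp; case: (d s).
Qed.

Section Cocycle.
Variable C : cE K -> bool.
Hypothesis C_par : forall s, C (cside s (d s) false) = C (cside s (d s) true).
Hypothesis C_fiber : forall s b, C (cside s (~~ d s) b) = false.

(* Three charts, whose indices are [None], [Some false] and [Some true], for the
   double cover with monodromy [C]: the points whose transverse coordinate is not
   1/2 in the strip of [C], the open squares of the strip, and the open edges of
   the strip with the half squares adjacent to them.  The value is [None] outside
   the chart, and [Some h] in it; the flip in the third chart compares the
   orientation of a square with that of its nearest transverse side. *)
Definition chartV (i : option bool) : option bool :=
  if i is None then Some false else None.

Definition chartE (i : option bool) (e : cE K) (t : R) : option bool :=
  match i with
  | None => if C e && (t == 2^-1) then None else Some false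
  | Some false => None
  | Some true => if C e && (0 < t < 1) then Some (2^-1 < t) else None
  end.

Definition chartS (i : option bool) (s : cS K) (a b : R) : option bool :=
  let c := C (cside s (d s) false) in
  match i with
  | None => if c && (a == 2^-1) then None else Some false
  | Some false => if [&& c, 0 < a < 1 & 0 < b < 1] then Some (2^-1 < a) else None
  | Some true => if [&& c, 0 < a < 1 & b != 2^-1]
      then Some (((0 < b < 1) || (a != 2^-1)) &&
                 ((2^-1 < a) (+) cflip s (d s) (2^-1 < b)))
      else None
  end.

(** The delicate points are the midpoints of transverse sides: a flip fixes 1/2, so the third chart
    is [false] there on the edge, and the guard in [chartS] imposes the same value from the
    square. *)
Lemma chart_ex i : exists F : X -> option bool,
  [/\ forall v, F (p (RV v)) = chartV i,
    forall e t, in01 t -> F (p (RE e t)) = chartE i e t &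
    forall s a b, in01 a -> in01 b -> F (p (sqp s a b)) = chartS i s a b].
Proof.
have h0 : (0 == 2^-1 :> R) = false by apply/eqP; lra.
have h1 : (1 == 2^-1 :> R) = false by apply/eqP; lra.
have l1 : 2^-1 < 1 :> R by lra.
have l0 : (2^-1 < 0 :> R) = false by apply/negP/negP; rewrite -leNgt; lra.
have bh b : (b2r R b == 2^-1) = false by case: b.
have bl b : (2^-1 < b2r R b) = b by case: b.
have b01 b : (0 < b2r R b < 1) = false by case: b; rewrite /= ltxx ?andbF.
have fh f u : (flipc f u == 2^-1) = (u == 2^-1).
  by rewrite /flipc; case: f => //; apply/eqP/eqP; lra.
have f01 f u : (0 < flipc f u < 1) = (0 < u < 1).
  rewrite /flipc; case: f => //.
  by apply/idP/idP => ?; lra.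
have fl f u : u != 2^-1 -> (2^-1 < flipc f u) = (2^-1 < u) (+) f.
  rewrite /flipc; case: f; last by rewrite addbF.
  rewrite addbT neq_lt => /orP[] h.
    have -> : (2^-1 < u) = false by apply/negP/negP; rewrite -leNgt; lra.
    by lra.
  rewrite h; apply/negP/negP; rewrite -leNgt; lra.
have Cb s b : C (cside s (d s) b) = C (cside s (d s) false).
  by case: b; rewrite // C_par.
apply: cell_fun.
- by move=> e; case: i => [[]|]; rewrite /chartE /= ?h0 ?ltxx ?andbF.
- by move=> e; case: i => [[]|]; rewrite /chartE /= ?h1 ?ltxx ?andbF.
- move=> s b u u01; case: i => [[]|]; rewrite /chartE /chartS /= ?Cb ?bh ?bl ?b01.
  + rewrite f01 andbT /=; case: ifP => // _; congr Some.
    case: (eqVneq u 2^-1) => [->|nu]; last by rewrite fl.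
    by rewrite /flipc; case: cflip => /=; apply/esym/negP/negP; rewrite -leNgt; lra.
  + by rewrite !andbF.
  + by rewrite fh.
- by move=> s b u u01; case: i => [[]|];
    rewrite /chartE /chartS /= ?C_fiber ?bh ?b01 /= ?andbF.
Qed.

Lemma zone_bool x x' : in01 x -> same_zone x x' ->
  [/\ (0 < x < 1) -> (0 < x' < 1) &
      x != 2^-1 -> x' != 2^-1 /\ (2^-1 < x') = (2^-1 < x)].
Proof.
move=> x01 [z1 z2 z3 z4]; split.
  by move=> /andP[/z1 -> /z2 ->].
rewrite neq_lt => /orP[h|h].
  have h' := z3 h; split; first by rewrite lt_eqF.
  by rewrite !ltNge !ltW.
have h' := z4 h; split; first by rewrite gt_eqF.
by rewrite h h'.
Qed.

(** The double cover has monodromy [C e] along each edge [e], and [kappa] is the potential of the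
    monodromy restricted to vertices. *)
Lemma edge_potential : simply_connected R X ->
  exists kappa : cV K -> bool, forall e, kappa (csrc e) (+) kappa (ctgt e) = C e.
Proof.
move=> Xsc.
have half01 : 0 < (2^-1 : R) < 1 by lra.
have [F HF] := choice chart_ex.
pose U i : set X := [set x | F i x <> None].
pose h i x := odflt false (F i x).
(* The part of the overlap of the charts [i] and [j] where they differ by [b]. Its openness says
   both that charts are open and that transitions are locally constant. *)
pose over i j b : set X := [set y |
  if F i y is Some u then if F j y is Some v then u (+) v = b else False else False].
have over_open i j b : open (over i j b).
  have [_ HEi HSi] := HF i; have [_ HEj HSj] := HF j.
  apply: zone_open_sqp => [e t t' t01 t01' zt|s x y x' y' x01 y01 x01' y01' zx zy].
    rewrite /over /= HEi // HEj // HEi // HEj //.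
    have [z1 z2] := zone_bool t01 zt; rewrite /chartE; move: z1 z2.
    case: (C e) => //; case: (eqVneq t 2^-1) => [->|nt] /=.
      rewrite half01.
      move=> /(_ isT) -> _.
      by case: i {HEi HSi} => [[]|]; case: j {HEj HSj} => [[]|] //=; rewrite ?addbb.
    case: (0 < t < 1) => [/(_ isT) ->|_] /(_ isT) [/negPf -> ->];
      by case: i {HEi HSi} => [[]|]; case: j {HEj HSj} => [[]|] //=; case: (0 < t' < 1).
  rewrite /over /= HSi // HSj // HSi // HSj //.
  have [z1 z2] := zone_bool x01 zx; have [w1 w2] := zone_bool y01 zy.
  rewrite /chartS; move: z1 z2 w1 w2.
  case: (C _) => //=.
  case: (eqVneq x 2^-1) => [->|nx] /=.
    rewrite half01.
    rewrite ltxx /=; move=> /(_ isT) -> _.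
    case: (eqVneq y 2^-1) => [->|ny] /=.
      rewrite half01.
      move=> /(_ isT) -> _.
      by case: i {HEi HSi} => [[]|]; case: j {HEj HSj} => [[]|] //=; rewrite ?addbb.
    case: (0 < y < 1) => [/(_ isT) ->|_] /(_ isT) [-> ->] /=.
      by case: i {HEi HSi} => [[]|]; case: j {HEj HSj} => [[]|] //=;
        case: (2^-1 < x'); case: (cflip s (d s) _).
    by case: i {HEi HSi} => [[]|]; case: j {HEj HSj} => [[]|] //=; rewrite addbb.
  case: (y != 2^-1) => /=; case: (0 < x < 1) => [/(_ isT) ->|_] /(_ isT) [nx' ->];
  rewrite (negPf nx') /=; case: (0 < y < 1) => [/(_ isT) ->|_];
  first [move=> /(_ isT) [-> ->] | move=> _];
  case: i {HEi HSi} => [[]|]; case: j {HEj HSj} => [[]|] //=; rewrite ?orbT ?addbb //=;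
  case: (0 < x' < 1) => //=; case: (0 < y' < 1) => //=; case: (y' != 2^-1) => //=; rewrite ?addbb.
have cover x : exists i, U i x.
  case: p_real => _ /(_ x)[a [va <-]] _ _.
  have [HV0 HE0 HS0] := HF None; have [_ HE1 HS1] := HF (Some false).
  have [_ HE2 HS2] := HF (Some true).
  have sq s x1 y1 : in01 x1 -> in01 y1 -> exists i, U i (p (sqp s x1 y1)).
    move=> x01 y01; rewrite /U.
    case: (eqVneq x1 2^-1) => [xh|nx]; last first.
      by exists None; rewrite /= HS0 //= (negPf nx) andbF.
    case Cs : (C (cside s (d s) false)); last first.
      by exists None; rewrite /= HS0 //= Cs.
    case: (eqVneq y1 2^-1) => [yh|ny].
      by exists (Some false); rewrite /= HS1 //= Cs xh yh half01.
    by exists (Some true); rewrite /= HS2 //= Cs xh ny half01.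
  case: a va => [v _|e t t01|s x1 y1 [x01 y01]].
  - by exists None; rewrite /U /= HV0.
  - case: (boolP (C e && (t == 2^-1))) => Ct.
      exists (Some true); rewrite /U /= HE2 //=.
      by case/andP: Ct => -> /eqP ->; rewrite half01.
    by exists None; rewrite /U /= HE0 //= (negPf Ct).
  - have := sq s x1 y1 x01 y01; have := sq s y1 x1 y01 x01.
    by rewrite /sqp; case: (d s).
have compat i j x : U i x -> U j x -> \forall y \near x,
    [/\ U i y, U j y & h i y (+) h j y = h i x (+) h j x].
  move=> Ui Uj.
  have : nbhs x (over i j (h i x (+) h j x)).
    apply: open_nbhs_nbhs; split; first exact: over_open.
    by move: Ui Uj; rewrite /U /over /h /=; case: (F i x) => //; case: (F j x).
  apply: filterS => y; rewrite /U /over /h /=.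
  by case: (F i y) => // a; case: (F j y) => // b ->.
have [kappa Hk] := monodromy_potential cover compat Xsc.
exists (fun v => kappa (p (RV v))) => e.
have cg := edge_path_continuous (e := e).
have p0 : p (RE e 0) = p (RV (csrc e)).
  by case: p_real => _ _ pinj _; apply/pinj => //=;
    [exact: (b2r_in01 false)|apply: rst_step; constructor].
have p1 : p (RE e 1) = p (RV (ctgt e)).
  by case: p_real => _ _ pinj _; apply/pinj => //=;
    [exact: (b2r_in01 true)|apply: rst_step; constructor].
(* On an edge of the class the lift jumps at the midpoint, where only the third chart is defined and
   its section jumps as well. *)
rewrite -p0 -p1 (Hk _ (fun t => C e && (2^-1 < t)) cg).
  have -> : (2^-1 < (0 : R)) = false by apply/negP/negP; rewrite -leNgt; lra.
  have -> : (2^-1 < (1 : R)) by lra.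
  by rewrite andbF andbT.
move=> i t t01; rewrite /U /h /=; have [_ HE _] := HF i; rewrite HE // => Ut.
apply: filterS (near_same_zone t) => w zw w01; rewrite HE //.
have [_ z2] := zone_bool t01 zw; move: z2 Ut; rewrite /chartE.
case: (C e); last by case: i {HE} => [[]|].
case: i {HE} => [[]|] //=; last by case: (eqVneq t 2^-1) => //= _ /(_ isT)[/negPf -> ->].
by case: (0 < t < 1) => // _ _; case: (0 < w < 1) => //; rewrite !addbb.
Qed.
End Cocycle.
End Direction.
End Complex.

(** * The coordinate of a parallelism class is constant on leaves *)

Section Flip.
Variable R : realType.

Lemma flipcD f g (u : R) : flipc f (flipc g u) = flipc (f (+) g) u.
Proof. by rewrite /flipc; case: f; case: g => //=; ring. Qed.

Lemma flipcK f (u : R) : flipc f (flipc f u) = u.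
Proof. by rewrite flipcD addbb. Qed.

Lemma flipc_b2r f b : flipc f (b2r R b) = b2r R (b (+) f).
Proof. by rewrite /flipc /b2r; case: f; case: b => /=; ring. Qed.

Lemma continuous_flipc f : continuous (@flipc R f).
Proof.
move=> t; rewrite /flipc; case: f; last exact: cvg_id.
by apply: cvgB; [exact: cvg_cst|exact: cvg_id].
Qed.
End Flip.

Section Gluing.
Variables (R : realType) (K : sqcx) (X : topologicalType) (p : rpt K R -> X).
Hypothesis p_real : realizes p.

Lemma p_glue a b : Defs.glue a b -> p a = p b.
Proof.
move=> ab; have [va vb] := glue_valid ab.
by case: p_real => _ _ pinj _; apply/pinj => //; exact: rst_step.
Qed.

Lemma p_endv e i : p (RE e (b2r R i)) = p (RV (endv e i)).
Proof. by apply: p_glue; case: i; constructor. Qed.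

Lemma p_side_par d s b u : in01 u ->
  p (sqp d s u (b2r R b)) = p (RE (cside s (d s) b) (flipc (cflip s (d s) b) u)).
Proof.
move=> u01; have := @glue_side R K s (d s) b u u01 => /p_glue.
by rewrite /sqpt /sqp; case: (d s).
Qed.

Lemma p_side_fiber d s b u : in01 u ->
  p (sqp d s (b2r R b) u) =
  p (RE (cside s (~~ d s) b) (flipc (cflip s (~~ d s) b) u)).
Proof.
move=> u01; have := @glue_side R K s (~~ d s) b u u01 => /p_glue.
by rewrite /sqpt /sqp; case: (d s).
Qed.

Lemma corner_endv (d : cS K -> bool) s a b :
  endv (cside s (d s) b) (a (+) cflip s (d s) b) =
  endv (cside s (~~ d s) a) (b (+) cflip s (~~ d s) a).
Proof.
have xorE x y : xorb x y = x (+) y by case: x; case: y.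
case: p_real => coh _ _ _; have := coh s a b; have := coh s b a.
rewrite /cornerA /cornerB /= !xorE; case: (d s) => /= H H'; last by rewrite H.
by rewrite H'.
Qed.
End Gluing.

(** * Leaves and their traces on cells *)

Section Model.
Variables (R : realType) (K : sqcx) (X : topologicalType) (p : rpt K R -> X)
  (D : set (set X)).
Hypothesis pD_model : model p D.

Let p_real : realizes p. Proof. by case: pD_model => -[]. Qed.
Let D_part : partition_of D. Proof. by case: pD_model => -[]. Qed.

Definition same_leaf (x x' : X) := exists L, [/\ D L, L x & L x'].

Lemma same_leaf_refl x : same_leaf x x.
Proof. by case: D_part => _ _ /(_ x)[L [DL Lx]]; exists L. Qed.

Lemma same_leaf_sym x y : same_leaf x y -> same_leaf y x.
Proof. by case=> L [? ? ?]; exists L. Qed.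

Lemma same_leaf_in L x y : D L -> L x -> same_leaf x y -> L y.
Proof.
move=> DL Lx [L' [DL' Lx' Ly]]; case: D_part => _ disj _.
by rewrite (disj L L') //; exists x.
Qed.

Lemma same_leaf_trans x y z : same_leaf x y -> same_leaf y z -> same_leaf x z.
Proof. by case=> L [DL Lx Ly] yz; exists L; split => //; exact: same_leaf_in yz. Qed.

Definition std_edge (e : cE K) := std_edge_decomp (edge_decomp p D e).

Lemma triv_edge_leaf e t t' : ~ std_edge e -> in01 t -> in01 t' ->
  same_leaf (p (RE e t)) (p (RE e t')).
Proof.
case: pD_model => -[_ _ _ _ [_ /(_ e) +]] _ => -[//|triv] _ t01 t01'.
have : edge_decomp p D e [set t | in01 t] by rewrite triv.
case=> L [u [DL _ E]]; exists L.
have sub w : in01 w -> L (p (RE e w)).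
  move=> w01; have : [set t | in01 t] w by [].
  by rewrite E => /connected_component_sub[].
by split => //; exact: sub.
Qed.

(** Otherwise the open interval would lie in one component of the trace of [L], but the components
    of a standard decomposition are points. *)
Lemma std_edge_gap e L a b : std_edge e -> D L -> 0 <= a -> a < b -> b <= 1 ->
  exists2 t, a < t < b & ~ L (p (RE e t)).
Proof.
move=> se DL a0 ab b1; apply: contrapT => nex.
have inL t : a < t < b -> L (p (RE e t)).
  by move=> tab; apply: contrapT => nL; apply: nex; exists t.
pose A := [set t' | in01 t' /\ L (p (RE e t'))].
pose m := (a + b) / 2.
have sub : `]a, b[%classic `<=` A.
  by move=> t /=; rewrite in_itv /= => tab; split; [rewrite /in01; lra|exact: inL].
have itvm t : a < t < b -> (`]a, b[%classic : set R) t by rewrite /= in_itv.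
have mab : a < m < b by rewrite /m; lra.
have : edge_decomp p D e (connected_component A m).
  by exists L, m; split => //; exact: (sub _ (itvm _ mab)).
rewrite se => -[t [_ Et]].
have cc : `]a, b[%classic `<=` connected_component A m.
  apply: connected_component_max => //.
  by apply/connected_intervalP; exact: interval_is_interval.
have /cc : (`]a, b[%classic : set R) m by exact: itvm mab.
have /cc : (`]a, b[%classic : set R) ((a + m) / 2) by apply: itvm; rewrite /m; lra.
by rewrite Et /m /= => E1 E2; lra.
Qed.

(** A side along the fibers lies in one leaf, so it is not standard. A transverse side that is not
    standard would lie in one leaf, hence in one fiber, although the transverse coordinate varies
    along it. *)
Lemma transverse_direction : exists d : cS K -> bool,
  [/\ forall s a b b', in01 a -> in01 b -> in01 b' ->
        same_leaf (p (sqp d s a b)) (p (sqp d s a b')),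
      forall s b, std_edge (cside s (d s) b) &
      forall s b, ~ std_edge (cside s (~~ d s) b)].
Proof.
case: pD_model => -[_ _ _ _ [sqstd edstd]] _.
(* The fiber at transverse coordinate [t], in the convention of [sqp] for [d s = j]. *)
pose fib (j : bool) (t : R) : set (R * R) :=
  if j then [set q | q.1 = t /\ in01 q.2] else [set q | in01 q.1 /\ q.2 = t].
have /choice[d Hd] s : exists j, sq_decomp p D s =
    [set F | exists t, in01 t /\ F = fib j t].
  by case: (sqstd s) => ->; [exists true|exists false].
exists d.
have fiber s a : in01 a -> exists2 L, D L & forall b, in01 b -> L (p (sqp d s a b)).
  move=> a01; have : sq_decomp p D s (fib (d s) a) by rewrite Hd; exists a.
  case=> L [q [DL _ E]]; exists L => // b b01.
  have : fib (d s) a (if d s then (a, b) else (b, a)) by rewrite /fib; case: (d s).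
  by rewrite E => /connected_component_sub[_]; rewrite /sqp; case: (d s).
have nonstd s b : ~ std_edge (cside s (~~ d s) b).
  move=> std; have [L DL HL] := fiber s (b2r R b) (b2r_in01 R b).
  have [t t01] := std_edge_gap std DL (lexx 0) ltr01 (lexx 1); apply.
  rewrite -(flipcK (cflip s (~~ d s) b) t) -p_side_fiber //.
    by apply: HL; apply: flipc_in01; rewrite /in01; lra.
  by apply: flipc_in01; rewrite /in01; lra.
split => // [s a b b' a01 b01 b01'|s b].
  by have [L DL HL] := fiber s a a01; exists L; split => //; exact: HL.
apply: contrapT => nstd.
have i0 := b2r_in01 R false.
have [L [DL L0 _]] := triv_edge_leaf nstd i0 i0.
have HL t : in01 t -> L (p (sqp d s t (b2r R b))).
  move=> t01; rewrite p_side_par //.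
  by apply: (same_leaf_in DL L0); apply: triv_edge_leaf => //; exact: flipc_in01.
pose A := [set q' | sq01 q' /\ L (p (RS s q'.1 q'.2))].
pose g t : R * R := if d s then (t, b2r R b) else (b2r R b, t).
have gA t : in01 t -> A (g t).
  move=> t01; have := HL t t01; have b01 := b2r_in01 R b.
  by rewrite /A /g /sqp; case: (d s).
have gc : continuous g.
  rewrite /g; case: (d s); apply: continuous_pair => t;
  by [exact: cvg_id|exact: cvg_cst].
have : sq_decomp p D s (connected_component A (g 0)).
  by exists L, (g 0); split => //; exact: gA.
rewrite Hd => -[t [_ Et]].
have cc : g @` @seg01 R `<=` connected_component A (g 0).
  apply: connected_component_max.
  - by exists 0.
  - by move=> _ [u u01 <-]; exact: gA.
  - apply: connected_continuous_connected.
      by rewrite seg01E; exact: segment_connected.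
    exact: continuous_subspaceT.
have /cc : (g @` @seg01 R) (g 1) by exists 1 => //; exact: (b2r_in01 R true).
have /cc : (g @` @seg01 R) (g 0) by exists 0.
rewrite Et /g /fib; case: (d s) => /= -[+ +] [+ +].
  by move=> <- _ /eqP; rewrite oner_eq0.
by move=> _ <- _ /eqP; rewrite oner_eq0.
Qed.

Section Transverse.
Variable d : cS K -> bool.
Hypothesis fiber_leaf : forall s a b b', in01 a -> in01 b -> in01 b' ->
  same_leaf (p (sqp d s a b)) (p (sqp d s a b')).
Hypothesis std_par : forall s b, std_edge (cside s (d s) b).
Hypothesis nstd_fiber : forall s b, ~ std_edge (cside s (~~ d s) b).

Definition parallel : cE K -> cE K -> Prop := clos_refl_sym_trans _
  (fun e e' => exists s, e = cside s (d s) false /\ e' = cside s (d s) true).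

Lemma parallel_std e e' : parallel e e' -> std_edge e <-> std_edge e'.
Proof.
by elim=> [x y [s [-> ->]]|x|x y _ ->|x y z _ -> _ ->].
Qed.

(** A level set of [phi] strictly between 0 and 1 lies in one leaf ([level]). So a leaf with two
    values of [phi] would, being connected, contain all points of [e0] with coordinate strictly
    between them, against [std_edge_gap]. The clauses on vertices and on nonparallel edges serve to
    tell the points of the quotient graph apart. *)
Lemma leaf_coordinate e0 : std_edge e0 -> exists phi : X -> R,
  [/\ forall t, in01 t -> phi (p (RE e0 t)) = t,
      forall v, exists b, phi (p (RV v)) = b2r R b,
      forall e t, ~ parallel e0 e -> in01 t -> phi (p (RE e t)) = phi (p (RV (csrc e))),
      forall x y, same_leaf x y -> phi x = phi y &
      forall e, parallel e0 e -> exists f, forall t, in01 t ->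
        same_leaf (p (RE e t)) (p (RE e0 (flipc f t)))].
Proof.
move=> std0.
pose C e := `[< parallel e0 e >].
have Cside s b : C (cside s (d s) b) = C (cside s (d s) false).
  case: b => //; apply/asboolP/asboolP => H; apply: rst_trans H _.
    by apply: rst_sym; apply: rst_step; exists s.
  by apply: rst_step; exists s.
have Cfiber s b : C (cside s (~~ d s) b) = false.
  apply/asboolP => /parallel_std [+ _] => /(_ std0); exact: nstd_fiber.
have [kap0 Hkap0] : exists kappa : cV K -> bool,
    forall e, kappa (csrc e) (+) kappa (ctgt e) = C e.
  apply: (edge_potential p_real (d := d)) => //.
  by case: pD_model => -[].
(* Normalized at the source of [e0], so that the coordinate on [e0] is [t] and not [1 - t]. *)
pose kap v := kap0 v (+) kap0 (csrc e0).
have kapE e i : kap (endv e i) = kap (csrc e) (+) (i && C e).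
  rewrite -Hkap0 /kap /endv; case: i => /=; last by rewrite addbF.
  by move: (kap0 (csrc e)) (kap0 (ctgt e)) (kap0 (csrc e0)) => [] [] [].
(* The two corners are the ends of a side along the fibers, where the cocycle vanishes. *)
have kap_square s a : kap (endv (cside s (d s) false) (a (+) cflip s (d s) false)) =
    kap (endv (cside s (d s) true) (a (+) cflip s (d s) true)).
  by rewrite !(corner_endv p_real d) [LHS]kapE [RHS]kapE Cfiber !andbF.
have kap_par s : kap (csrc (cside s (d s) false)) (+)
     (cflip s (d s) false && C (cside s (d s) false)) =
    kap (csrc (cside s (d s) true)) (+)
     (cflip s (d s) true && C (cside s (d s) false)).
  by have := kap_square s false; rewrite [LHS]kapE [RHS]kapE !addFb Cside.
(* On an edge of the class the coordinate runs from the end where [kap] is false to the end where it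
   is true. *)
pose fE e t : R := if C e then flipc (kap (csrc e)) t else b2r R (kap (csrc e)).
have fE_end e i : fE e (b2r R i) = b2r R (kap (endv e i)).
  rewrite kapE /fE; case: (C e); last by rewrite andbF addbF.
  by rewrite flipc_b2r andbT addbC.
have [|||| phi [phiV phiE phiS]] := @cell_fun R K X p p_real d R
  (fun v => b2r R (kap v)) fE
  (fun s a b => fE (cside s (d s) false) (flipc (cflip s (d s) false) a)).
- by move=> e; have := fE_end e false.
- by move=> e; have := fE_end e true.
- move=> s [] u u01 //; have := kap_par s; rewrite /fE Cside.
  case: (C _) => /=; last by rewrite !andbF !addbF => ->.
  by rewrite !andbT !flipcD => ->.
- move=> s b u u01; rewrite flipc_b2r fE_end (corner_endv p_real) kapE.
  by rewrite /fE Cfiber andbF addbF.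
have fE_cont e : continuous (fE e).
  rewrite /fE; case: (C e); first exact: continuous_flipc.
  by move=> t; exact: cvg_cst.
have fE01 e t : in01 t -> in01 (fE e t).
  move=> t01; rewrite /fE; case: ifP => _; [exact: flipc_in01|exact: b2r_in01].
have sqE s x y : exists a b, RS s x y = sqp d s a b /\ (valid (RS s x y : rpt K R) ->
    in01 a /\ in01 b).
  by rewrite /sqp; case: (d s); [exists x, y|exists y, x]; split => // -[].
have phi01 x : in01 (phi x).
  case: p_real => _ /(_ x)[[v|e t|s x1 y1] [va <-]] _ _.
  - by rewrite phiV; exact: b2r_in01.
  - by rewrite phiE //; exact: fE01.
  - have [a [b [E /(_ va)[a01 b01]]]] := sqE s x1 y1.
    by rewrite E phiS //; apply: fE01; exact: flipc_in01.
have phi_cont : continuous phi.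
  apply/continuousP => W oW; apply: (weak_open p_real) => [e t t01|s x y x01 y01].
    rewrite /= phiE // => Wt; have nW : nbhs (fE e t) W by exact: open_nbhs_nbhs.
    by apply: filterS (near_continuous (@fE_cont e) nW) => w Ww w01; rewrite /= phiE.
  pose pr (w : R * R) := if d s then w.1 else w.2.
  pose F w := fE (cside s (d s) false) (flipc (cflip s (d s) false) (pr w)).
  have FE w : sq01 w -> phi (p (RS s w.1 w.2)) = F w.
    case: w => w1 w2 [/= ? ?]; rewrite /F /pr.
    have := phiS s w1 w2; have := phiS s w2 w1; rewrite /sqp.
    by case: (d s) => /= H H'; [exact: H'|exact: H].
  have cpr : continuous pr.
    by rewrite /pr; case: (d s) => z; [exact: cvg_fst|exact: cvg_snd].
  have cF : continuous F.
    move=> z; apply: (@continuous_comp _ _ _ pr (fun u => fE _ (flipc _ u))).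
      exact: cpr.
    apply: (@continuous_comp _ _ _ (flipc _) (fE _)); first exact: continuous_flipc.
    exact: fE_cont.
  rewrite /= (FE (x, y)) // => Wt.
  have nW : nbhs (F (x, y)) W by exact: open_nbhs_nbhs.
  by apply: filterS (near_continuous cF nW) => w Ww w01; rewrite /= FE.
(* A point slides along the fibers of squares from one edge of the class to another; [kap] at the
   two sources decides whether the parameter is reversed. *)
have slide e e' : parallel e e' -> parallel e0 e -> forall t, in01 t ->
    same_leaf (p (RE e t)) (p (RE e' (flipc (kap (csrc e) (+) kap (csrc e')) t))).
  elim=> [_ _ [s [-> ->]] par t t01|x _ t t01|x y xy IH y0 t t01|
          x y z xy IH1 yz IH2 x0 t t01].
  - have Cs : C (cside s (d s) false) by exact/asboolP.
    have := kap_par s; rewrite Cs !andbT => kp.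
    set f0 := cflip s (d s) false in kp *; set f1 := cflip s (d s) true in kp *.
    have u01 : in01 (flipc f0 t) by exact: flipc_in01.
    have -> : kap (csrc (cside s (d s) false)) (+) kap (csrc (cside s (d s) true)) = f1 (+) f0.
      move: kp; clear; move: f0 f1 (kap (csrc (cside s (d s) false))).
      by move: (kap (csrc (cside s (d s) true))) => [] [] [] [].
    rewrite -flipcD -{1}(flipcK f0 t).
    rewrite -(p_side_par p_real d s false) // -(p_side_par p_real d s true) //.
    by apply: fiber_leaf => //; exact: b2r_in01.
  - by rewrite addbb; exact: same_leaf_refl.
  - set f := _ (+) _; have x0 : parallel e0 x by apply: rst_trans y0 _; exact: rst_sym.
    have := IH x0 (flipc f t) (flipc_in01 f t01).
    by rewrite addbC -/f flipcK; exact: same_leaf_sym.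
  - have y0 : parallel e0 y by exact: rst_trans x0 xy.
    apply: same_leaf_trans (IH1 x0 t t01) _.
    have := IH2 y0 _ (flipc_in01 (kap (csrc x) (+) kap (csrc y)) t01).
    rewrite flipcD; suff -> : kap (csrc y) (+) kap (csrc z) (+)
       (kap (csrc x) (+) kap (csrc y)) = kap (csrc x) (+) kap (csrc z) by [].
    by move: (kap (csrc x)) (kap (csrc y)) (kap (csrc z)) => [] [] [].
have kap00 : kap (csrc e0) = false by rewrite /kap addbb.
have to_e0 e : C e -> forall t, in01 t -> same_leaf (p (RE e t)) (p (RE e0 (fE e t))).
  move=> Ce t t01; rewrite /fE Ce; move/asboolP: Ce => par.
  have := slide e e0 (rst_sym _ _ _ _ par) par t t01.
  by rewrite kap00 addbF.
have edge_level e t : in01 t -> 0 < fE e t < 1 -> same_leaf (p (RE e t)) (p (RE e0 (fE e t))).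
  case Ce : (C e) => t01; first by move=> _; exact: to_e0.
  by rewrite /fE Ce; case: (kap _); rewrite /b2r ltxx ?andbF.
have level x : 0 < phi x < 1 -> same_leaf x (p (RE e0 (phi x))).
  case: p_real => _ /(_ x)[[v|e t|s x1 y1] [va <-]] _ _.
  - by rewrite phiV; case: (kap v); rewrite /b2r ltxx ?andbF.
  - by rewrite phiE //; exact: edge_level.
  - have [a [b [E /(_ va)[a01 b01]]]] := sqE s x1 y1.
    rewrite E phiS // => H; apply: same_leaf_trans (fiber_leaf s a01 b01 (b2r_in01 R false)) _.
    by rewrite p_side_par //; apply: edge_level => //; exact: flipc_in01.
exists phi; split.
- move=> t t01; rewrite phiE // /fE /C asboolT ?kap00 //; exact: rst_refl.
- by move=> v; exists (kap v).
- move=> e t npar t01; rewrite phiE // phiV /fE /C.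
  by case: asboolP.
- move=> x y [L [DL Lx Ly]].
  have conn : connected (phi @` L).
    apply: connected_continuous_connected; first by case: pD_model => _; exact.
    exact: continuous_subspaceT.
  have /connected_intervalP itv := conn.
  have le u v : L u -> L v -> ~ (phi u < phi v).
    move=> Lu Lv uv; have := phi01 u; have := phi01 v; rewrite /in01 => v1 u0.
    have [t tuv] : exists2 t, phi u < t < phi v & ~ L (p (RE e0 t)).
      by apply: std_edge_gap => //; lra.
    apply.
    have [w Lw wt] : (phi @` L) t.
      by apply: (itv (phi u) (phi v)); [exists u|exists v|lra].
    rewrite -wt; apply: (same_leaf_in DL Lw); apply: level.
    by rewrite wt; lra.
  by case: (ltgtP (phi x) (phi y)) => // /le; tauto.
- by move=> e par; exists (kap (csrc e)) => t t01; have := @to_e0 e;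
    rewrite /fE /C asboolT //; exact.
Qed.

End Transverse.
End Model.

(** * The quotient tree *)

Lemma quotient_space (X : topologicalType) (E : X -> X -> Prop) :
  (forall x, E x x) -> (forall x y, E x y -> E y x) ->
  (forall x y z, E x y -> E y z -> E x z) ->
  exists (Y : topologicalType) (q : X -> Y),
    [/\ (forall y, exists x, q x = y), (forall x x', q x = q x' <-> E x x') &
        (forall U : set Y, open U <-> open (q @^-1` U))].
Proof.
move=> Er Es Et.
pose e x y := `[< E x y >].
have re : reflexive e by move=> x; apply/asboolP.
have se : symmetric e by move=> x y; apply/asboolP/asboolP; exact: Es.
have te : transitive e.
  by move=> x y z /asboolP xy /asboolP yz; apply/asboolP; exact: Et xy yz.
pose er := EquivRel e re se te.
exists (quotient_topology {eq_quot er}%qT), (\pi_{eq_quot er})%qT; split.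
- by move=> y; exists (repr y); rewrite reprK.
- by move=> x x'; split=> [/eqmodP/asboolP|H]; last exact/eqmodP/asboolP.
- by [].
Qed.

(** [Q] consists of the classes as subsets of [A], and [io] chooses representatives. It provides
    both the vertices and the edges of the tree. *)
Lemma class_representatives (A : Type) (P : A -> Prop) (E : A -> A -> Prop) :
  (forall x, E x x) -> (forall x y, E x y -> E y x) ->
  (forall x y z, E x y -> E y z -> E x z) ->
  exists (Q : Type) (io : Q -> A), [/\ forall c, P (io c),
    forall c c', E (io c) (io c') -> c = c' & forall a, P a -> exists c, E a (io c)].
Proof.
move=> Er Es Et.
pose Q := {S : set A | exists a, P a /\ S = E a}.
pose io (c : Q) := projT1 (cid (proj2_sig c)).
have ioP (c : Q) : P (io c) /\ sval c = E (io c) := projT2 (cid (proj2_sig c)).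
exists Q, io; split=> [c|c c' cc'|a Pa].
- by case: (ioP c).
- have : sval c = sval c'.
    rewrite (ioP c).2 (ioP c').2; apply/seteqP; split => x H; last exact: Et H.
    by apply: Et H; exact: Es.
  case: c c' {cc'} => S HS [S' HS'] /= SS'; move: HS HS'; rewrite SS' => HS HS'.
  by congr exist; exact: Prop_irrelevance.
- exists (exist _ (E a) (ex_intro _ a (conj Pa erefl))).
  set c := exist _ _ _; have /= -> := (ioP c).2; exact: Er.
Qed.

(** * Connectedness of the 1-skeleton *)

Section Connectivity.
Variables (R : realType) (K : sqcx) (X : topologicalType) (p : rpt K R -> X).
Hypothesis p_real : realizes p.

Definition edge_connected : cV K -> cV K -> Prop := clos_refl_sym_trans _
  (fun v w => exists e, v = csrc e /\ w = ctgt e).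

Lemma edge_connected_endv e i : edge_connected (csrc e) (endv e i).
Proof.
by case: i; [apply: rst_step; exists e|exact: rst_refl].
Qed.

(** Membership in the edge component of [v] is the same at all vertices of a cell, so it extends to
    a function on [X] constant on each cell. Its level sets are open, hence it is constant along a
    path from [v] to [w]. *)
Lemma simply_connected_edge_connected v w :
  simply_connected R X -> edge_connected v w.
Proof.
case=> _ /(_ (p (RV v)) (p (RV w)))[g [gc [g0 g1]]] _.
pose B u := `[< edge_connected v u >].
have BE u u' : edge_connected u u' -> B u = B u'.
  move=> uu'; apply/asboolP/asboolP => H; apply: rst_trans H _ => //.
  exact: rst_sym.
have BV e i : B (endv e i) = B (csrc e).
  by apply/esym/BE; exact: edge_connected_endv.
(* An arbitrary choice, which only fixes the coordinate that [sqp] lists first. *)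
pose d (_ : cS K) := true.
have Bsq s a b : B (csrc (cside s (d s) b)) = B (csrc (cside s (~~ d s) a)).
  by rewrite -(BV _ (a (+) cflip s (d s) b)) (corner_endv p_real d) BV.
have [|||| F [FV FE FS]] := @cell_fun R K X p p_real d bool B
  (fun e _ => B (csrc e)) (fun s _ _ => B (csrc (cside s (d s) false))).
- by [].
- by move=> e; rewrite -(BV e true).
- by move=> s b u _; rewrite !(Bsq s false).
- by move=> s b u _; rewrite (Bsq s b).
have Fo b : open [set x | F x = b].
  apply: (zone_open_sqp p_real (d := d)) => [e t t' t01 t01' _|s x y x' y' x01 y01 x01' y01' _ _] /=.
    by rewrite !FE.
  by rewrite !FS.
have cg : cont_on (@seg01 R) g by rewrite seg01E; exact/within_continuousP.
have := @locally_constant_segment R 0 1 (F \o g) ler01.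
rewrite /= g0 g1 !FV /B asboolT; last exact: rst_refl.
move=> H; apply/asboolP; rewrite -H // => t t01.
have nF : nbhs (g t) [set x | F x = F (g t)] by apply: open_nbhs_nbhs; split.
exact: cg t t01 _ nF.
Qed.
End Connectivity.

(** * Walks and acyclicity in graphs *)

Section Walks.
Variable G : graph.

Lemma walk_cat (x y z : gV G) l l' : walk x l y -> walk y l' z -> walk x (l ++ l') z.
Proof.
by elim: l x => [x /= -> //|c l IH x [cx cl] yz]; split => //; exact: IH.
Qed.

Lemma walk_avoid (T : Type) (f : gV G -> T) (e : gE G) l x y :
  (forall e', e' <> e -> f (gsrc e') = f (gtgt e')) ->
  walk x l y -> ~ List.In e (List.map fst l) -> f x = f y.
Proof.
move=> fe; elim: l x => [x /= ->//|[e' b] l IH x [/= <- cl] /= nin].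
rewrite -(IH _ cl); last by move=> H; apply: nin; right.
have e'e : e' <> e by move=> H; apply: nin; left.
by rewrite /dtail /dhead /=; case: b {cl}; rewrite fe.
Qed.

(** In a closed walk with distinct edges the rest of the walk avoids the first edge [e], so [f]
    would agree at the ends of [e]. *)
Lemma cut_edges_acyclic :
  (forall e : gE G, exists f : gV G -> bool, f (gsrc e) <> f (gtgt e) /\
     forall e', e' <> e -> f (gsrc e') = f (gtgt e')) ->
  forall (x : gV G) l, walk x l x -> l <> nil -> ~ List.NoDup (List.map fst l).
Proof.
move=> cut x [//|[e b] l] /= [<- cl] _ nd; have [f [fe fe']] := cut e.
have nin : ~ List.In e (List.map fst l) by inversion nd.
apply: fe; have := walk_avoid fe' cl nin.
by rewrite /dhead /dtail /=; case: b {cl}.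
Qed.
End Walks.

(* If (X, D) is a model, then X/D is naturally a graph, and this graph is a
   tree: there is a tree T and a space Y realizing T (weak topology) together
   with a quotient map q : X -> Y whose fibers are exactly the leaves (so Y is
   the decomposition space X/D), the vertices of T corresponding exactly to
   the leaves that contain vertices of X. *)
Theorem mainTheorem3 (R : realType) (K : sqcx) (X : topologicalType)
    (p : rpt K R -> X) (D : set (set X)) :
  model p D ->
  exists (T : graph) (Y : topologicalType) (pY : rpt (graph_cx T) R -> Y)
         (q : X -> Y),
    is_tree T /\ realizes pY /\
    [/\ (forall y : Y, exists x, q x = y),
        (forall x x' : X, q x = q x' <-> exists L, [/\ D L, L x & L x']),
        (forall U : set Y, open U <-> open (q @^-1` U)) &
        (forall x : X, (exists v, q x = pY (RV v)) <->
                       exists L, [/\ D L, L x & exists w, L (p (RV w))])].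
Proof.
move=> pD; have p_real : realizes p by case: pD => -[].
have Xsc : simply_connected R X by case: pD => -[].
pose same := same_leaf D.
have sr x : same x x by exact: same_leaf_refl pD x.
have ss x y : same x y -> same y x by exact: same_leaf_sym.
have st x y z : same x y -> same y z -> same x z by exact: (same_leaf_trans pD).
have [d [fiber std_par nstd]] := transverse_direction pD.
pose par := parallel d.
have coord := leaf_coordinate pD fiber std_par nstd.
have [Y [q [qsurj qE qopen]]] := quotient_space sr ss st.
(* Vertices of the tree: vertices of [X] modulo lying in the same leaf. *)
have [TV [ioV [_ ioVinj clVex]]] := @class_representatives (cV K) (fun _ => True)
  (fun v w => same (p (RV v)) (p (RV w))) (fun v => sr _) (fun v w => @ss _ _)
  (fun u v w => @st _ _ _).
have /choice[clV clVP] v : exists c, same (p (RV v)) (p (RV (ioV c))) by exact: clVex.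
(* Edges of the tree: parallelism classes of standard edges; the trivial edges are collapsed by
   [q]. *)
have [TE [ioE [ioEstd ioEinj clEex]]] := @class_representatives (cE K) (std_edge p D)
  par (fun e => rst_refl _ _ e) (fun e e' => @rst_sym _ _ e e')
  (fun e e' e'' => @rst_trans _ _ e e' e'').
pose T := @Graph TV TE (fun e => clV (csrc (ioE e))) (fun e => clV (ctgt (ioE e))).
pose pY (a : rpt (graph_cx T) R) : Y := match a with
  | RV v => q (p (RV (ioV v)))
  | RE e t => q (p (RE (ioE e) t))
  | RS s _ _ => match s with end end.
pose rV (v : TV) : rpt (graph_cx T) R := @RV (graph_cx T) R v.
pose rE (c : TE) (t : R) : rpt (graph_cx T) R := @RE (graph_cx T) R c t.
have in0 : in01 (0 : R) := b2r_in01 R false.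
have in1 : in01 (1 : R) := b2r_in01 R true.
have p0 e : p (RE e 0) = p (RV (csrc e)) := p_endv p_real e false.
have p1 e : p (RE e 1) = p (RV (ctgt e)) := p_endv p_real e true.
have qclV v : q (p (RV (ioV (clV v)))) = q (p (RV v)) by apply/qE/ss.
have qclE e : std_edge p D e -> exists (c : TE) f, forall t, in01 t ->
    q (p (RE e t)) = pY (rE c (flipc f t)).
  move=> se; have [c ec] := clEex e se; have [_ [_ _ _ _ H]] := coord _ (ioEstd c).
  have [f Hf] := H e (rst_sym _ _ _ _ ec).
  by exists c, f => t t01; apply/qE; exact: Hf.
have qtriv e t : ~ std_edge p D e -> in01 t -> q (p (RE e t)) = q (p (RV (csrc e))).
  by move=> ne t01; rewrite -p0; apply/qE; exact: (triv_edge_leaf pD).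
(* [q] collapses a square along its fibers onto one transverse side. *)
have qsq s x y : in01 x -> in01 y -> q (p (RS s x y)) =
    q (p (RE (cside s (d s) false) (flipc (cflip s (d s) false) (if d s then x else y)))).
  move=> x01 y01; have -> : RS s x y = sqp d s (if d s then x else y) (if d s then y else x).
    by rewrite /sqp; case: (d s).
  have x01' : in01 (if d s then x else y) by case: ifP.
  rewrite -(p_side_par p_real d s false) //; apply/qE; apply: fiber => //.
  by case: ifP.
exists T, Y, pY, q; split; [split|split; [split|split]] => //.
- case: Xsc => [[x _] _ _]; case: p_real => _ /(_ x)[[v|e t|s x1 x2] _] _ _.
  + by exists (clV v).
  + by exists (clV (csrc e)).
  + by exists (clV (csrc (cside s false false))).
- move=> x y.
  (* Walks in both directions are built together, since [edge_connected] is a symmetric closure. *)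
  have walkE (e : cE K) : exists l l', walk (clV (csrc e) : gV T) l (clV (ctgt e)) /\
      walk (clV (ctgt e) : gV T) l' (clV (csrc e)).
    have inj v w : q (p (RV v)) = q (p (RV w)) -> clV v = clV w.
      by move=> H; apply: ioVinj; apply/qE; rewrite !qclV.
    case: (pselect (std_edge p D e)) => [se|ne]; last first.
      have E : clV (csrc e) = clV (ctgt e) by apply: inj; rewrite -(qtriv e 1) // p1.
      by exists nil, nil; split.
    have [c [f Hf]] := qclE e se.
    have := Hf 0 in0; have := Hf 1 in1; rewrite p0 p1 /flipc /=.
    case: f {Hf}; rewrite ?subrr ?subr0 !p0 !p1 => /inj -> /inj ->.
      by exists ((c, true) :: nil), ((c, false) :: nil).
    by exists ((c, false) :: nil), ((c, true) :: nil).
  have walkK v w : edge_connected v w -> exists l l',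
      walk (clV v : gV T) l (clV w) /\ walk (clV w : gV T) l' (clV v).
    elim=> [_ _ [e [-> ->]]|u|u u' _ [l [l' [? ?]]]|u u' u'' _ [l [l' [wl wl']]] _
      [m [m' [wm wm']]]].
    + exact: walkE.
    + by exists nil, nil.
    + by exists l', l.
    + by exists (l ++ m), (m' ++ l'); split;
        [exact: walk_cat wl wm|exact: walk_cat wm' wl'].
  have clVK c : clV (ioV c) = c by exact/ioVinj/ss/clVP.
  have [l [_ [xy _]]] := walkK _ _ (simply_connected_edge_connected p_real (ioV x) (ioV y) Xsc).
  by exists l; rewrite !clVK in xy.
- apply: cut_edges_acyclic => c; have [phi [phi0 _ phin phil _]] := coord _ (ioEstd c).
  have phiV v : phi (p (RV (ioV (clV v)))) = phi (p (RV v)) by exact/phil/ss/clVP.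
  (* The cut separates the vertices by the coordinate of the class [c]; every other edge of the tree
     represents another class, along which this coordinate is constant. *)
  exists (fun v => phi (p (RV (ioV v))) == 0); split=> /=.
    by rewrite !phiV -p0 -p1 !phi0 // eqxx oner_eq0.
  move=> c' cc'; rewrite !phiV -p1 phin //.
  by move=> /ioEinj H; apply: cc'.
- move=> y; have [x <-] := qsurj y; case: p_real => _ /(_ x)[a [va <-]] _ _.
  have edge e t : in01 t -> exists b, valid b /\ pY b = q (p (RE e t)).
    move=> t01; case: (pselect (std_edge p D e)) => [se|ne].
      have [c [f Hf]] := qclE e se; exists (rE c (flipc f t)).
      by split; [exact: flipc_in01|rewrite Hf].
    by exists (rV (clV (csrc e))); split => //; rewrite qtriv // -qclV.
  case: a va => [v|e t|s x1 y1] /=.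
  + by exists (rV (clV v)); split => //=; rewrite qclV.
  + exact: edge.
  + by move=> [x01 y01]; rewrite qsq //; apply: edge; apply: flipc_in01; case: ifP.
- have pY_glued a b : glued a b -> pY a = pY b.
    elim=> [_ _ [e|e|[]]|x|x y _ ->|x y z _ -> _ ->] //=.
      by rewrite p0 -qclV.
    by rewrite p1 -qclV.
  (* Each point of the graph is a vertex or an interior point of an edge; the coordinates [phi] then
     separate these normal forms. *)
  have normal a : valid a -> (exists v, glued a (rV v)) \/
      (exists c t, 0 < t < 1 /\ glued a (rE c t)).
    case: a => [v _|c t|[]]; first by left; exists v; exact: rst_refl.
    move=> /andP[]; rewrite le_eqVlt => /orP[/eqP <- _|t0].
      by left; exists (clV (csrc (ioE c))); apply: rst_step; constructor.
    rewrite le_eqVlt => /orP[/eqP ->|t1].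
      by left; exists (clV (ctgt (ioE c))); apply: rst_step; constructor.
    by right; exists c, t; split; [rewrite t0|exact: rst_refl].
  have in_lt (t : R) : 0 < t < 1 -> in01 t by rewrite /in01; lra.
  have nb2r t b : 0 < t < 1 -> t <> b2r R b.
    by move=> + E; rewrite E /b2r; case: b {E}; rewrite ltxx ?andbF.
  have EV c t v : 0 < t < 1 -> pY (rE c t) <> pY (rV v).
    move=> t01 /qE H; have [phi [phi0 phiV _ phil _]] := coord _ (ioEstd c).
    have [b Hb] := phiV (ioV v); apply: (nb2r t b t01).
    by rewrite -Hb -(phil _ _ H) phi0 //; exact: in_lt.
  have EE c t c' t' : 0 < t < 1 -> 0 < t' < 1 -> pY (rE c t) = pY (rE c' t') ->
      rE c t = rE c' t'.
    move=> t01 t01' /qE H; have [phi [phi0 phiV phin phil _]] := coord _ (ioEstd c).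
    have Ht : phi (p (RE (ioE c') t')) = t.
      by rewrite -(phil _ _ H) phi0 //; exact: in_lt.
    case: (pselect (par (ioE c) (ioE c'))) => [/ioEinj E|npar].
      by move: Ht; rewrite -E phi0; [move=> ->|exact: in_lt].
    (* On an edge of another class [phi] keeps its value at a vertex, which is 0 or 1 and so differs
       from [t]. *)
    have [b Hb] := phiV (csrc (ioE c')); case: (nb2r t b t01).
    by rewrite -Hb -Ht phin //; exact: in_lt.
  move=> a b va vb; split; last exact: pY_glued.
  have [[v av]|[c [t [t01 at_]]]] := normal a va;
  have [[w bw]|[c' [t' [t01' bt]]]] := normal b vb.
  + rewrite (pY_glued _ _ av) (pY_glued _ _ bw) => /qE /ioVinj vw.
    by apply: rst_trans av _; apply: rst_sym; rewrite vw.
  + by rewrite (pY_glued _ _ av) (pY_glued _ _ bt) => /esym /EV; case.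
  + by rewrite (pY_glued _ _ at_) (pY_glued _ _ bw) => /EV; case.
  + rewrite (pY_glued _ _ at_) (pY_glued _ _ bt) => /EE E.
    by apply: rst_trans at_ _; apply: rst_sym; rewrite E.
- move=> U; split=> [/qopen oU|[UE _]].
    split=> [c|[]]; case: p_real => _ _ _ popen.
    by have [/(_ (ioE c)) + _] := (popen _).1 oU.
  (* On a standard edge [q] is, up to a flip, the parametrization of an edge of the tree, and on a
     trivial edge it is constant; so openness pulls back to the 1-cubes, and from there to squares
     through the projection [F]. *)
  have edge e t : in01 t -> U (q (p (RE e t))) ->
      \forall w \near t, in01 w -> U (q (p (RE e w))).
    move=> t01; case: (pselect (std_edge p D e)) => [se|ne]; last first.
      rewrite qtriv // => Ut; apply: (@filterE _ (nbhs t)) => w w01.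
      by rewrite qtriv.
    have [c [f Hf]] := qclE e se; rewrite Hf // => Ut.
    have /open_inP HU := UE c; rewrite -seg01E in HU.
    have := near_continuous (@continuous_flipc R f) (HU _ (flipc_in01 f t01) Ut).
    by apply: filterS => w Hw w01; rewrite Hf //; apply: Hw; exact: flipc_in01.
  apply/qopen; apply: (weak_open p_real) => [e t|s x y x01 y01] /=; first exact: edge.
  rewrite qsq //.
  pose pr (w : R * R) := if d s then w.1 else w.2.
  pose F w := flipc (cflip s (d s) false) (pr w).
  have cF : continuous F.
    move=> z; apply: (@continuous_comp _ _ _ pr (flipc _)); last exact: continuous_flipc.
    by rewrite /pr; case: (d s); [exact: cvg_fst|exact: cvg_snd].
  have prE (w : R * R) : sq01 w -> in01 (F w).
    by move=> [w1 w2]; apply: flipc_in01; rewrite /pr; case: ifP.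
  move=> Ut; have := near_continuous (z := (x, y)) cF (edge _ _ (prE (x, y) (conj x01 y01)) Ut).
  apply: filterS => w Hw w01; case: (w01) => w1 w2.
  by rewrite qsq //; apply: Hw; exact: prE.
- move=> x; split=> [[v /qE [L [DL Lx Lv]]]|[L [DL Lx [w Lw]]]].
    by exists L; split => //; exists (ioV v).
  by exists (clV w); rewrite /= qclV; apply/qE; exists L.
Qed.
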